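(* Let $p\ge0$ be an integer, $C=-\frac{p(p+1)}2$, $V=\mathbb C[g_2,g_3,\wp,\wp']/(\wp'^2-4\wp^3+g_2\wp+g_3)$ with $\partial_x\wp=\wp'$, and let $b(\lambda,x)=\sum_{k\ge-1}b_k\lambda^{-k-1}$, $b_{-1}=1$, $b_k\in V$, be the unique such series with $$b\,b_{xx}-\tfrac12b_x^2-2(\lambda-2C\wp)b^2=-2\lambda.$$ Let $S_p(\lambda)$ be the spectral polynomial of $L=\partial_x^2-p(p+1)\wp$ (see context). Then $\sqrt{S_p(\lambda)/\lambda}\;b(\lambda,x)$ is a polynomial in $\lambda$ of degree $p$ with leading coefficient $1$, and a polynomial of degree $p$ in $\wp$. Moreover: for $p=1$: $b=2\sqrt\lambda\,\dfrac{\lambda-\wp}{\sqrt{4\lambda^3-g_2\lambda-g_3}}$; for $p=2$: $b=\dfrac12\sqrt\lambda\,\dfrac{4\lambda^2-12\wp\lambda+36\wp^2-9g_2}{\sqrt{(\lambda^2-3g_2)(4\lambda^3-9g_2\lambda+27g_3)}}$; for $p=3$: $b=\dfrac{4\lambda^3-24\wp\lambda^2+60(3\wp^2-g_2)\lambda-900\wp^3+225g_2\wp+225g_3}{\sqrt{16\lambda^6-504g_2\lambda^4+2376g_3\lambda^3+4185g_2^2\lambda^2-36450g_2g_3\lambda-3375g_2^3+91125g_3^2}}$.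
   Context: $\wp=\wp(x;\tau)$ is the Weierstrass function with invariants $g_2,g_3$ (so $\wp''=6\wp^2-g_2/2$). The spectral polynomial (spectral curve $y^2=S_p(\lambda)$) of the finite-gap operator $L=\partial_x^2-p(p+1)\wp$ is the unique monic polynomial $S_p$ of degree $2p+1$ in $\lambda$ such that $A^2=S_p(L)$ for a differential operator $A$ of order $2p+1$ with leading coefficient $1$ commuting with $L$; e.g. $S_0=\lambda$, $S_1=\lambda^3-\frac{g_2}4\lambda-\frac{g_3}4$, $S_2=(\lambda^2-3g_2)(\lambda^3-\frac94g_2\lambda+\frac{27}4g_3)$. Square roots of polynomials in $\lambda$ are expanded as formal series in $\lambda^{-1}$ with leading coefficient $\lambda^{d/2}$ ($d$ the degree). *)

(* Defs.v *)
From HB Require Import structures.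
From mathcomp Require Import all_boot all_order all_algebra.
Set Implicit Arguments. Unset Strict Implicit. Unset Printing Implicit Defensive.
Import GRing.Theory.
Local Open Scope ring_scope.

(* Formal series in lambda^{-1}: u : nat -> R, u n = coefficient of lambda^{-n}
   (relative to a leading power of lambda fixed by the context). *)
Definition smul (R : nzRingType) (a b : nat -> R) (n : nat) : R :=
  \sum_(i < n.+1) a i * b (n - i)%N.

Definition revc (R : nzRingType) (d : nat) (N : {poly R}) (n : nat) : R :=
  if (n <= d)%N then N`_(d - n) else 0.

(* Rings:  K = F[g2,g3],  P = K[wp],  W = P[wp'];
   V = W / (wp'^2 - (4 wp^3 - g2 wp - g3)), handled via the congruence eqV. *)
Notation Kp F := {poly {poly F}}.
Notation Pp F := {poly Kp F}.
Notation Wp F := {poly Pp F}.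

Section Defs.
Variable F : fieldType.

Definition g2 : Kp F := 'X.
Definition g3 : Kp F := ('X : {poly F})%:P.
Definition wp : Pp F := 'X.
Definition kP (k : Kp F) : Pp F := k%:P.
Definition kW (k : Kp F) : Wp F := k%:P%:P.
Definition cF (c : F) : Kp F := c%:P%:P.
Definition wpW : Wp F := wp%:P.

(* wp'^2 = 4 wp^3 - g2 wp - g3 *)
Definition fwp : Pp F := 4%:R * wp ^+ 3 - kP g2 * wp - kP g3.
(* wp'' = 6 wp^2 - g2/2 *)
Definition ellwp : Pp F := 6%:R * wp ^+ 2 - kP (cF 2^-1 * g2).
Definition relW : Wp F := 'X ^+ 2 - fwp%:P.

Definition eqV (a c : Wp F) : Prop := exists q : Wp F, a - c = q * relW.

(* the derivation d/dx: dg2 = dg3 = 0, d wp = wp', d wp' = 6 wp^2 - g2/2 *)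
Definition Dx (h : Wp F) : Wp F :=
  map_poly (fun c : Pp F => c^`()) h * 'X + h^`() * ellwp%:P.

(* b(lambda) = sum_n b n lambda^{-n} (b n = b_{n-1} of the paper), satisfying
   b b_xx - 1/2 b_x^2 - 2 (lambda - 2 C wp) b^2 = -2 lambda,  C = -p(p+1)/2,
   coefficientwise in V, together with b_{-1} = 1. *)
Definition bseries (p : nat) (b : nat -> Wp F) : Prop :=
  eqV (b 0%N) 1 /\
  eqV (- 2%:R * smul b b 0%N) (- 2%:R) /\
  forall n : nat,
    eqV (smul b (fun i => Dx (Dx (b i))) n
         - kW (cF 2^-1) * smul (fun i => Dx (b i)) (fun i => Dx (b i)) n
         - 2%:R * smul b b n.+1
         - (2 * (p * p.+1))%:R * wpW * smul b b n) 0.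

(* Differential operators sum_i a`_i d^i with coefficients in V *)
Definition opmul (a c : seq (Wp F)) : seq (Wp F) :=
  mkseq (fun m => \sum_(i < size a) \sum_(j < size c) \sum_(k < i.+1)
           (if (i + j == m + k)%N then a`_i * ('C(i, k)%:R * iter k Dx c`_j)
            else 0)) (size a + size c).
Definition opadd (a c : seq (Wp F)) : seq (Wp F) :=
  mkseq (fun i => a`_i + c`_i) (maxn (size a) (size c)).
Definition opexp (a : seq (Wp F)) (n : nat) : seq (Wp F) :=
  iter n (opmul a) [:: 1].
Definition eqop (a c : seq (Wp F)) : Prop := forall i, eqV a`_i c`_i.
Definition Lop (p : nat) : seq (Wp F) := [:: - (p * p.+1)%:R * wpW; 0; 1].
Definition polyop (S : {poly Kp F}) (A : seq (Wp F)) : seq (Wp F) :=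
  foldr (fun i acc => opadd acc (opmul [:: kW S`_i] (opexp A i)))
        [::] (iota 0 (size S)).

Definition is_spectral (p : nat) (S : {poly Kp F}) : Prop :=
  S \is monic /\ size S = (2 * p + 2)%N /\
  exists A : seq (Wp F),
    [/\ size A = (2 * p + 2)%N, eqV A`_(2 * p + 1) 1,
        eqop (opmul A (Lop p)) (opmul (Lop p) A)
      & eqop (opmul A A) (polyop S (Lop p))].

(* sqrt(D) = a * lambda^{d/2} * (sum_n r n lambda^{-n}), D of degree d with
   leading coefficient a^2 *)
Definition sqrt_ser (d : nat) (D : {poly Kp F}) (a : Kp F) (r : nat -> Kp F)
  : Prop :=
  r 0%N = 1 /\ forall n, a ^+ 2 * smul r r n = revc d D n.

Definition rb (r : nat -> Kp F) (b : nat -> Wp F) (n : nat) : Wp F :=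
  smul (fun i => kW (r i)) b n.

Definition D1 : {poly Kp F} := Poly [:: - g3; - g2; 0; 4%:R].
Definition D2 : {poly Kp F} :=
  Poly [:: - (3%:R * g2); 0; 1] * Poly [:: 27%:R * g3; - (9%:R * g2); 0; 4%:R].
Definition D3 : {poly Kp F} :=
  Poly [:: - (3375%:R * g2 ^+ 3) + 91125%:R * g3 ^+ 2; - (36450%:R * g2 * g3);
           4185%:R * g2 ^+ 2; 2376%:R * g3; - (504%:R * g2); 0; 16%:R].
Definition N1 : {poly Pp F} := Poly [:: - wp; 1].
Definition N2 : {poly Pp F} :=
  Poly [:: 36%:R * wp ^+ 2 - 9%:R * kP g2; - (12%:R * wp); 4%:R].
Definition N3 : {poly Pp F} :=
  Poly [:: - (900%:R * wp ^+ 3) + 225%:R * kP g2 * wp + 225%:R * kP g3;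
           60%:R * (3%:R * wp ^+ 2 - kP g2); - (24%:R * wp); 4%:R].

End Defs.

(* Main.v *)
(* Given [b 0 = 1], the quadratic equation determines the series [b], and
   multiplying [b] by a series [r] constant in x multiplies the right-hand side by
   r^2; hence [sqrt(S/lambda) b] is the unique normalised solution with right-hand
   side [-2 S].

   On a formal solution psi of psi'' = (lambda + u) psi, u = p(p+1) wp, an
   operator A acts as A psi = f psi' + h psi with f, h polynomials in lambda, and
   f monic of degree p when A is monic of order 2p+1.  If A commutes with L then
   A psi is again a lambda-eigenvector of L, so A^2 = S(L) reads
   f(f' + 2h) = 0 and S = h^2 + f(h' + (lambda + u) f).  As f is monic,
   h = -f'/2, and -2 S = f f'' - f'^2/2 - 2 (lambda + u) f^2.  By uniqueness
   f = sqrt(S/lambda) b, which is therefore a polynomial in lambda.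

   The recursion for [b n] stays inside polynomials in wp and raises the degree by
   at most one; the coefficient a_n of wp^n in [b n] satisfies
   4(n+1) a_(n+1) = 2(2n+1)(n(n+1) - p(p+1)) a_n, so a_p is not zero.  For
   p = 1, 2, 3 the displayed numerators satisfy the same equation, and uniqueness
   applies again. *)
Require Import Defs.
From HB Require Import structures.
From mathcomp Require Import all_boot all_order all_algebra.
From mathcomp Require Import ring zify.
Import GRing.Theory.
Local Open Scope ring_scope.
Set Implicit Arguments.
Unset Strict Implicit.

(** * Series in the inverse of lambda *)

Section Series.
Variable R : comNzRingType.
Implicit Types (a b c d : nat -> R) (f g : {poly R}).

Lemma smul_coefE a b f g n :
  (forall i, (i <= n)%N -> a i = f`_i) -> (forall i, (i <= n)%N -> b i = g`_i) ->
  smul a b n = (f * g)`_n.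
Proof.
move=> af bg; rewrite coefM; apply: eq_bigr => i _.
by rewrite af ?bg ?leq_subr // -ltnS.
Qed.

Lemma coef_trunc a n i : (i <= n)%N -> a i = (\poly_(j < n.+1) a j)`_i.
Proof. by move=> le_in; rewrite coef_poly ltnS le_in. Qed.

(** Only coefficients up to [n] enter, so identities between convolutions reduce to identities in
    the commutative ring of polynomials. *)
Lemma smul_trunc a b m n :
  (n <= m)%N -> smul a b n = (\poly_(j < m.+1) a j * \poly_(j < m.+1) b j)`_n.
Proof.
by move=> le_nm; apply: smul_coefE => i le_in; apply: coef_trunc;
  apply: leq_trans le_nm.
Qed.

Lemma eq_smul a b c d n :
  (forall i, (i <= n)%N -> a i = c i) -> (forall i, (i <= n)%N -> b i = d i) ->
  smul a b n = smul c d n.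
Proof.
move=> ac bd; rewrite (smul_trunc c d (leqnn n)).
by apply: smul_coefE => i le_in; rewrite -coef_trunc // (ac, bd).
Qed.

Lemma smulC a b n : smul a b n = smul b a n.
Proof. by rewrite !(smul_trunc _ _ (leqnn n)) mulrC. Qed.

Lemma smulACA a b c d n :
  smul (smul a b) (smul c d) n = smul (smul a c) (smul b d) n.
Proof.
have smul2 (x y z t : nat -> R) : smul (smul x y) (smul z t) n =
    ((\poly_(j < n.+1) x j * \poly_(j < n.+1) y j) *
     (\poly_(j < n.+1) z j * \poly_(j < n.+1) t j))`_n.
  by apply: smul_coefE => i; apply: smul_trunc.
by rewrite !smul2 mulrACA.
Qed.

Lemma smulDr a b c n : smul a (fun i => b i + c i) n = smul a b n + smul a c n.
Proof. by rewrite -big_split; apply: eq_bigr => i _; rewrite mulrDr. Qed.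

Lemma smulZr a x b n : smul a (fun i => x * b i) n = x * smul a b n.
Proof. by rewrite mulr_sumr; apply: eq_bigr => i _; rewrite mulrCA. Qed.

Lemma smulBr a b c n : smul a (fun i => b i - c i) n = smul a b n - smul a c n.
Proof. by rewrite -sumrB; apply: eq_bigr => i _; rewrite mulrBr. Qed.

Lemma smul0 a b : smul a b 0 = a 0%N * b 0%N.
Proof. by rewrite /smul big_ord1. Qed.

Lemma smulSr a b n : smul a b n.+1 = smul a (fun i => b i.+1) n + a n.+1 * b 0%N.
Proof.
rewrite /smul big_ord_recr /= subnn; congr (_ + _).
by apply: eq_bigr => i _; rewrite subSn // -ltnS.
Qed.

(** A series with constant term 1 is not a zero divisor; this later cancels the factor [beta] in a
    differentiated equation. *)
Lemma smul_eq0 a b : a 0%N = 1 -> (forall n, smul a b n = 0) -> forall n, b n = 0.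
Proof.
move=> a0 ab0; elim/ltn_ind => n IHn.
have := ab0 n; rewrite /smul big_ord_recl a0 mul1r subn0 big1 ?addr0 //.
by move=> i _ /=; rewrite IHn ?mulr0 // /bump; have := ltn_ord i; lia.
Qed.

Lemma coefM_sum2 f g P Q n : (size f <= P)%N -> (size g <= Q)%N ->
  (f * g)`_n =
    \sum_(i < P) \sum_(j < Q) (if (i + j == n)%N then f`_i * g`_j else 0).
Proof.
have polyE (h : {poly R}) m : (size h <= m)%N -> h = \sum_(i < m) h`_i *: 'X^i.
  move=> le_hm; rewrite -poly_def; apply/polyP => i; rewrite coef_poly.
  by case: ltnP => // le_mi; rewrite nth_default // (leq_trans le_hm).
move=> /polyE{1}-> /polyE{1}->; rewrite big_distrlr /= coef_sum.
apply: eq_bigr => i _; rewrite coef_sum; apply: eq_bigr => j _.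
rewrite -scalerAl -scalerAr scalerA -exprD coefZ coefXn eq_sym.
by case: eqP; rewrite ?mulr1 ?mulr0.
Qed.

(** [revc P f] is the expansion of lambda^(-P) f in 1/lambda, hence multiplicative. The proof
    reverses both indices in the double sum for a product coefficient. *)
Lemma smul_revc P Q f g n : (size f <= P.+1)%N -> (size g <= Q.+1)%N ->
  smul (revc P f) (revc Q g) n = revc (P + Q) (f * g) n.
Proof.
move=> sf sg; pose rv T (h : {poly R}) := \poly_(i < T.+1) h`_(T - i).
have rvE T h i : revc T h i = (rv T h)`_i by rewrite coef_poly ltnS /revc.
rewrite (@smul_coefE _ _ (rv P f) (rv Q g)) => [|i _|i _]; rewrite ?rvE //.
rewrite (@coefM_sum2 _ _ P.+1 Q.+1) ?size_poly // (reindex_inj rev_ord_inj) /=.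
rewrite coef_poly ltnS; case: leqP => [le_n|lt_n].
  rewrite (coefM_sum2 _ sf sg); apply: eq_bigr => i _.
  rewrite (reindex_inj rev_ord_inj) /=; apply: eq_bigr => j _.
  rewrite !coef_poly; have := ltn_ord i; have := ltn_ord j => ltj lti.
  have -> : (P - (P.+1 - i.+1) = i)%N by lia.
  have -> : (Q - (Q.+1 - j.+1) = j)%N by lia.
  have -> : (P.+1 - i.+1 < P.+1)%N by lia.
  have -> : (Q.+1 - j.+1 < Q.+1)%N by lia.
  by have -> : (P.+1 - i.+1 + (Q.+1 - j.+1) == n)%N
      = (i + j == P + Q - n)%N by lia.
rewrite big1 // => i _; rewrite big1 // => j _.
by case: eqP => // ijn; have := ltn_ord j; lia.
Qed.

End Series.

(** * Derivations and their extension to polynomials *)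

Definition is_deriv (R : nzRingType) (D : R -> R) : Prop :=
  (forall x y, D (x + y) = D x + D y) /\
  (forall x y, D (x * y) = D x * y + x * D y).

Section Derivation.
Variable R : comNzRingType.

Variable D : R -> R.
Hypothesis derD : is_deriv D.

Lemma der_add x y : D (x + y) = D x + D y. Proof. exact: derD.1. Qed.
Lemma der_mul x y : D (x * y) = D x * y + x * D y. Proof. exact: derD.2. Qed.

Lemma der0 : D 0 = 0.
Proof. by apply: (addrI (D 0)); rewrite -der_add !addr0. Qed.

Lemma der1 : D 1 = 0.
Proof.
by apply: (addrI (D 1));
  rewrite addr0 -[in RHS](mulr1 1) der_mul mul1r mulr1.
Qed.

Lemma derN x : D (- x) = - D x.
Proof. by apply: (addIr (D x)); rewrite -der_add !addNr der0. Qed.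

Lemma derB x y : D (x - y) = D x - D y.
Proof. by rewrite der_add derN. Qed.

Lemma der_sum I (r : seq I) (P : pred I) (f : I -> R) :
  D (\sum_(i <- r | P i) f i) = \sum_(i <- r | P i) D (f i).
Proof. by apply: (big_ind2 (fun x y => D x = y)) => [|x a y b <- <-|//];
  rewrite ?der0 ?der_add. Qed.

Lemma der_nat n : D n%:R = 0.
Proof. by elim: n => [|n IHn]; rewrite ?der0 // mulrS der_add der1 IHn addr0. Qed.

Lemma der_natM n x : D (n%:R * x) = n%:R * D x.
Proof. by rewrite der_mul der_nat mul0r add0r. Qed.

Lemma der_smul (a b : nat -> R) n :
  D (smul a b n) = smul (D \o a) b n + smul a (D \o b) n.
Proof. by rewrite der_sum -big_split; apply: eq_bigr => i _; rewrite der_mul. Qed.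

Lemma coef_der (f : {poly R}) i : (map_poly D f)`_i = D f`_i.
Proof. by rewrite coef_map_id0 ?der0. Qed.

Lemma size_der (f : {poly R}) n : (size f <= n)%N -> (size (map_poly D f) <= n)%N.
Proof. by move=> sf; apply: leq_trans sf; apply: size_poly. Qed.

Lemma der_polyC x : map_poly D x%:P = (D x)%:P.
Proof. by apply/polyP => i; rewrite coef_der !coefC; case: eqP; rewrite ?der0. Qed.

Lemma der_polyX : map_poly D 'X = 0.
Proof.
apply/polyP => i; rewrite coef_der coefX coef0.
by case: eqP; rewrite ?der0 ?der1.
Qed.

Lemma is_deriv_map : is_deriv (map_poly D).
Proof.
split=> f g; apply/polyP => i; rewrite coefD !coef_der ?coefD ?der_add //.
rewrite !coefM der_sum -big_split; apply: eq_bigr => j _.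
by rewrite der_mul !coef_der.
Qed.

Lemma revc_der p (f : {poly R}) n : revc p (map_poly D f) n = D (revc p f n).
Proof. by rewrite /revc coef_der; case: ifP; rewrite ?der0. Qed.

End Derivation.

(* A series [c] stands for [sum_n c_n t^n] with [t = 1/lambda].  Multiplied by
   [t], the equation [c c_xx - c_x^2 / 2 - 2 (lambda + u) c^2 = - 2 lambda s]
   reads [t (c c_xx - c_x^2 / 2 - 2 u c^2) - 2 c^2 = - 2 s]; [hf] is [1/2]. *)
Section Equation.
Variables (R : comNzRingType) (D : R -> R) (u hf : R).
Hypothesis derD : is_deriv D.
Hypothesis hf2 : 2%:R * hf = 1.
Implicit Types (b c d r s : nat -> R).

Definition eqK c n : R :=
  smul c (D \o (D \o c)) n - hf * smul (D \o c) (D \o c) n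
  - 2%:R * u * smul c c n.

Definition solves s c : Prop :=
  smul c c 0 = s 0%N /\
  forall n, eqK c n - 2%:R * smul c c n.+1 = - 2%:R * s n.+1.

Lemma mul2_inj (x y : R) : 2%:R * x = 2%:R * y -> x = y.
Proof.
move=> /(congr1 ( *%R hf)); rewrite !mulrA [hf * _]mulrC hf2.
by rewrite !mul1r.
Qed.

Lemma eq_eqK c d n : (forall i, (i <= n)%N -> c i = d i) -> eqK c n = eqK d n.
Proof.
move=> cd; congr (_ - hf * _ - _ * _); apply: eq_smul => i le_in //=;
  by rewrite cd.
Qed.

(** [eqK c n] involves only [c 0] up to [c n], while [smul c c n.+1] contains [c n.+1] exactly as
    [2 * c 0 * c n.+1]. With [c 0 = 1], the equation at index [n] determines [4 * c n.+1], and 2 is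
    cancelled twice. *)
Lemma solves_inj s c d : c 0%N = 1 -> d 0%N = 1 ->
  solves s c -> solves s d -> forall n, c n = d n.
Proof.
move=> c0 d0 [_ sc] [_ sd]; elim/ltn_ind => -[|n] IHn; first by rewrite c0.
have IH i : (i <= n)%N -> c i = d i by move=> le_in; apply: IHn; rewrite ltnS.
have := sd n; rewrite -(sc n) (eq_eqK IH) => /addrI/oppr_inj/mul2_inj.
(* Both end terms of the convolution are split off; the inner sum runs over indices already known to
   agree. *)
rewrite !smulSr c0 d0 !mulr1 !(smulC _ (fun i => _ i.+1)).
rewrite /smul !big_ord_recr /= !subnn c0 d0 !mulr1.
have -> : \sum_(i < n) c i.+1 * c (n - i)%N = \sum_(i < n) d i.+1 * d (n - i)%N.
  by apply: eq_bigr => i _; rewrite !IH ?leq_subr.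
by rewrite -!addrA => /addrI eq2; apply: mul2_inj; rewrite !mulr_natl !mulr2n.
Qed.

Lemma eqK_scale r b n : (forall i, D (r i) = 0) ->
  eqK (smul r b) n = smul (smul r r) (eqK b) n.
Proof.
move=> Dr.
have Drs x m : D (smul r x m) = smul r (D \o x) m.
  rewrite (der_smul derD) [X in X + _]big1 ?add0r // => i _.
  by rewrite /= Dr mul0r.
rewrite /eqK !smulBr !smulZr (smulACA r r b (D \o (D \o b))).
rewrite (smulACA r r (D \o b) (D \o b)) (smulACA r r b b).
congr (_ - hf * _ - _); apply: eq_smul => i _ //=; rewrite ?Drs ?Drs //.
Qed.

(** By the equation, [eqK b] is twice the shift of b^2 - s. Multiplying by r^2 leaves only boundary
    terms, which cancel because [smul b b 0 = s 0]. *)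
Lemma solves_scale r s b : (forall i, D (r i) = 0) ->
  solves s b -> solves (smul (smul r r) s) (smul r b).
Proof.
move=> Dr [b0 sb]; split.
  by rewrite !smul0 in b0 *; rewrite -b0; ring.
move=> n; rewrite eqK_scale //.
have eqKb m : eqK b m = 2%:R * (smul b b m.+1 - s m.+1).
  by rewrite mulrBr -[in RHS]mulNr -(sb m); ring.
rewrite (@eq_smul _ _ _ (smul r r) (fun m => 2%:R * (smul b b m.+1 - s m.+1))) //.
rewrite smulZr smulBr smulACA !smulSr b0; ring.
Qed.

(** The polynomial equation is divided by lambda^(2p+1), which leaves a series identity in
    1/lambda. *)
Lemma solves_revc p (f S : {poly R}) : let f' := map_poly D f in
  (size f <= p.+1)%N ->
  f * map_poly D f' - hf%:P * f' ^+ 2 - 2%:R * ('X + u%:P) * f ^+ 2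
    = - 2%:R * S ->
  solves (revc (p + p).+1 S) (revc p f).
Proof.
move=> f' sf eqS; have sf' := size_der D sf; have sf'' := size_der D sf'.
have rD : D \o revc p f =1 revc p f' by move=> i /=; rewrite revc_der.
have rDD : D \o (D \o revc p f) =1 revc p (map_poly D f').
  by move=> i; rewrite /= revc_der //; congr (D _); apply: rD.
have eqKE n : eqK (revc p f) n =
    revc (p + p) (f * map_poly D f') n - hf * revc (p + p) (f' ^+ 2) n
    - 2%:R * u * revc (p + p) (f ^+ 2) n.
  by rewrite -!smul_revc //; congr (_ - hf * _ - _); apply: eq_smul => i _.
have szM (g h : {poly R}) : (size g <= p.+1)%N -> (size h <= p.+1)%N ->
    (g * h)`_(p + p).+1 = 0.
  move=> sg sh; rewrite nth_default //.
  by apply: leq_trans (size_polyMleq _ _) _; lia.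
have eqc n : (f * map_poly D f')`_n - hf * (f' ^+ 2)`_n
    - 2%:R * u * (f ^+ 2)`_n - 2%:R * ('X * f ^+ 2)`_n = - 2%:R * S`_n.
  rewrite -[RHS]coefCM.
  have <- : f * map_poly D f' - hf%:P * f' ^+ 2 - (2%:R * u)%:P * f ^+ 2
      - 2%:R%:P * ('X * f ^+ 2) = (- 2%:R)%:P * S.
    by rewrite polyCM polyCN polyC_natr -eqS; ring.
  by rewrite !coefB !coefCM.
split.
  (* In degree 2p+1 the only term on the left is ['X * f ^+ 2], which gives the initial
     condition. *)
  rewrite smul_revc // /revc !subn0 /= -expr2; apply: mul2_inj.
  have := eqc (p + p).+1; rewrite coefXM /= !expr2 !szM //.
  rewrite !mulr0 !subr0 sub0r mulNr.
  by move/oppr_inj.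
move=> n; rewrite eqKE smul_revc // /revc subSS ltnS -expr2.
have [le_n|lt_n] := leqP n (p + p); last first.
  by rewrite (leqNgt n.+1) leqW //= !mulr0 !subr0.
rewrite -eqc coefXM subnS; congr (_ - _ * _).
(* At [n = p + p] the constant coefficient of ['X * f ^+ 2] is 0, in agreement with the default
   value of [revc] past its degree. *)
have -> : (p + p - n == 0)%N = ~~ (n < p + p)%N by lia.
by case: ltnP.
Qed.

End Equation.

(** * Differential operators acting on a module with connection *)

Section Operators.
Variables (F : fieldType) (R : comNzRingType) (M : lmodType R).
Variables (tau : {rmorphism Wp F -> R}) (d : R -> R) (nab : M -> M).
Hypothesis derd : is_deriv d.
Hypothesis tauD : forall h, tau (Dx h) = d (tau h).
Hypothesis nabD : forall m n, nab (m + n) = nab m + nab n.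
Hypothesis nabZ : forall a m, nab (a *: m) = d a *: m + a *: nab m.

Definition act (A : seq (Wp F)) (m : M) : M :=
  \sum_(i < size A) tau A`_i *: iter i nab m.

Lemma nab0 : nab 0 = 0.
Proof. by apply: (addrI (nab 0)); rewrite -nabD !addr0. Qed.

Lemma nab_sum I (r : seq I) (P : pred I) (f : I -> M) :
  nab (\sum_(i <- r | P i) f i) = \sum_(i <- r | P i) nab (f i).
Proof.
by apply: (big_ind2 (fun x y => nab x = y)) => [|x a y b <- <-|//];
  rewrite ?nab0 ?nabD.
Qed.

Lemma iter_nab_sum n I (r : seq I) (P : pred I) (f : I -> M) :
  iter n nab (\sum_(i <- r | P i) f i) = \sum_(i <- r | P i) iter n nab (f i).
Proof. by elim: n => //= n ->; rewrite nab_sum. Qed.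

Lemma nabMn m n : nab (m *+ n) = nab m *+ n.
Proof. by elim: n => [|n IHn]; rewrite ?nab0 // !mulrS nabD IHn. Qed.

(** Leibniz formula for a power of the connection, by induction with Pascal's rule; its binomials
    are those of [opmul]. *)
Lemma iter_nabZ n a m : iter n nab (a *: m) =
  \sum_(k < n.+1) (iter k d a *: iter (n - k) nab m) *+ 'C(n, k).
Proof.
elim: n => [|n IHn]; first by rewrite big_ord1.
rewrite iterS IHn nab_sum.
transitivity (\sum_(k < n.+1) (iter k.+1 d a *: iter (n - k) nab m) *+ 'C(n, k)
            + \sum_(k < n.+1) (iter k d a *: iter (n.+1 - k) nab m) *+ 'C(n, k)).
  rewrite -big_split; apply: eq_bigr => k _ /=.
  by rewrite nabMn nabZ mulrnDl subSn // -ltnS.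
rewrite [in RHS]big_ord_recl [X in _ + X]big_ord_recl /= !bin0 addrCA.
congr (_ + _); rewrite [X in X + _]big_ord_recr [in RHS]big_ord_recr /=.
rewrite /bump /= !add1n !binn !subSS !subnn addrAC.
rewrite -big_split; congr (_ + _); apply: eq_bigr => k _ /=.
by rewrite /bump /= !add1n subSS binS mulrnDr addrC.
Qed.

Lemma tauDn n h : tau (iter n (@Dx F) h) = iter n d (tau h).
Proof. by elim: n => //= n <-; rewrite tauD. Qed.

Lemma act_wide A N m : (size A <= N)%N ->
  act A m = \sum_(i < N) tau A`_i *: iter i nab m.
Proof.
move=> le_AN; rewrite /act.
rewrite (big_ord_widen _ (fun i => tau A`_i *: iter i nab m) le_AN).
rewrite big_mkcond; apply: eq_bigr => i _; case: ltnP => // le_Ai.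
by rewrite nth_default // rmorph0 scale0r.
Qed.

Lemma act_eq A B m : (forall i, tau A`_i = tau B`_i) -> act A m = act B m.
Proof.
move=> eqAB; rewrite (act_wide _ (leq_maxl (size A) (size B))).
rewrite (act_wide _ (leq_maxr (size A) (size B))).
by apply: eq_bigr => i _; rewrite eqAB.
Qed.

Lemma act_opmul A B m : act (opmul A B) m = act A (act B m).
Proof.
rewrite /act size_mkseq.
transitivity (\sum_(i < size A) \sum_(j < size B) \sum_(k < i.+1)
   (tau A`_i * ('C(i, k)%:R * iter k d (tau B`_j))) *: iter (i + j - k) nab m).
  (* The sum over the output order [n] is moved innermost. The test in [opmul] then selects the
     single order [i + j - k], which lies within the length of [opmul A B]. *)
  under eq_bigr => n _ do rewrite nth_mkseq // raddf_sum scaler_suml.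
  rewrite exchange_big; apply: eq_bigr => i _ /=.
  under eq_bigr => n _ do rewrite raddf_sum scaler_suml.
  rewrite exchange_big; apply: eq_bigr => j _ /=.
  under eq_bigr => n _ do rewrite raddf_sum scaler_suml.
  rewrite exchange_big; apply: eq_bigr => k _ /=.
  have lt_n : (i + j - k < size A + size B)%N.
    by have := ltn_ord i; have := ltn_ord j; lia.
  rewrite (bigD1 (Ordinal lt_n)) //= big1 ?addr0 => [|n neq_n].
    have -> : (i + j == i + j - k + k)%N by have := ltn_ord k; lia.
    by rewrite !rmorphM rmorph_nat tauDn.
  have -> : (i + j == n + k)%N = false.
    by apply: contra_neqF neq_n => /eqP ijn; apply: val_inj => /=; lia.
  by rewrite rmorph0 scale0r.
apply: eq_bigr => i _; rewrite iter_nab_sum scaler_sumr.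
apply: eq_bigr => j _; rewrite iter_nabZ scaler_sumr.
apply: eq_bigr => k _; rewrite -iterD -scaler_nat !scalerA.
have -> : (i + j - k = i - k + j)%N by have := ltn_ord k; lia.
by rewrite mulrA.
Qed.

Lemma act_opadd A B m : act (opadd A B) m = act A m + act B m.
Proof.
rewrite (act_wide _ (leq_maxl (size A) (size B))).
rewrite (act_wide _ (leq_maxr (size A) (size B))) /act size_mkseq -big_split.
by apply: eq_bigr => i _; rewrite nth_mkseq // rmorphD scalerDl.
Qed.

Lemma act_const h m : act [:: h] m = tau h *: m.
Proof. by rewrite /act big_ord1. Qed.

Lemma act_schrodinger a m : act [:: a; 0; 1] m = tau a *: m + nab (nab m).
Proof.
rewrite /act !big_ord_recl big_ord0 addr0; congr (_ + _).
rewrite -[RHS]add0r; congr (_ + _).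
  by rewrite [LHS](_ : _ = tau 0 *: nab m) // rmorph0 scale0r.
by rewrite [LHS](_ : _ = tau 1 *: nab (nab m)) // rmorph1 scale1r.
Qed.

Lemma actZ A a m : d a = 0 -> act A (a *: m) = a *: act A m.
Proof.
move=> da; rewrite /act scaler_sumr; apply: eq_bigr => i _.
have -> : iter i nab (a *: m) = a *: iter i nab m.
  by elim: (val i) => //= n ->; rewrite nabZ da scale0r add0r.
by rewrite !scalerA mulrC.
Qed.

(** Powers of [L] act on the eigenvector by powers of [x], because each [x ^+ i] is again killed by
    [d]. *)
Lemma act_polyop (S : {poly Kp F}) L x m : d x = 0 -> act L m = x *: m ->
  act (polyop S L) m = (\sum_(i < size S) tau (kW S`_i) * x ^+ i) *: m.
Proof.
move=> dx Lm; rewrite /polyop.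
rewrite -(big_mkord xpredT (fun i => tau (kW S`_i) * x ^+ i)).
rewrite /index_iota subn0.
have powL i : act (opexp L i) m = x ^+ i *: m.
  elim: i => [|i IHi]; first by rewrite act_const rmorph1.
  rewrite /opexp iterS act_opmul -/(opexp L i) IHi actZ ?Lm ?scalerA -?exprSr //.
  elim: i {IHi} => [|i IHi]; first exact: (der1 derd).
  by rewrite exprS (der_mul derd) IHi dx mul0r mulr0 addr0.
elim: (iota _ _) => [|i s IHs] /=; first by rewrite big_nil scale0r /act big_ord0.
by rewrite act_opadd act_opmul IHs powL act_const big_cons scalerDl scalerA addrC.
Qed.

End Operators.

(** * From the commuting operator to a solution polynomial in lambda *)

Section Spectral.
Variables (F : fieldType) (V : comNzRingType) (pi : {rmorphism Wp F -> V}).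
Variables (D : V -> V) (hf : V) (p : nat).
Hypothesis derD : is_deriv D.
Hypothesis hf2 : 2%:R * hf = 1.
Hypothesis piD : forall h, pi (Dx h) = D (pi h).
Hypothesis pi_eqV : forall a c, eqV a c -> pi a = pi c.

Let u : V := (p * p.+1)%:R * pi (wpW F).
Let d := map_poly D.
Let M : Type := ({poly V}^o * {poly V}^o)%type.
Let tau : {rmorphism Wp F -> {poly V}} := polyC \o pi.

(* [(s, t)] stands for [s psi + t psi'], where [psi'' = (lambda + u) psi]. *)
Let nab (m : M) : M := (d m.1 + ('X + u%:P) * m.2, m.1 + d m.2).
Let psi : M := (1, 0).

Let derd : is_deriv d := is_deriv_map derD.

Lemma nab_add (m n : M) : nab (m + n) = nab m + nab n.
Proof.
by rewrite /nab /= !(der_add derd) mulrDr; congr (_, _);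
  rewrite /= addrACA.
Qed.

Lemma nab_scale a (m : M) : nab (a *: m) = d a *: m + a *: nab m.
Proof.
case: m => s t; rewrite /nab /= !(der_mul derd).
by congr pair; rewrite /= /GRing.scale /=; ring.
Qed.

Lemma tau_der h : tau (Dx h) = d (tau h).
Proof. by rewrite /= piD -(der_polyC derD). Qed.

Local Notation actM := (@act F {poly V} M tau nab).

Lemma nab_psi : nab psi = (0, 1).
Proof. by rewrite /nab /= (der1 derd) (der0 derd) mulr0 !addr0. Qed.

Lemma act_Lop m : actM (Lop F p) m = nab (nab m) - u%:P *: m.
Proof.
rewrite /Lop act_schrodinger addrC.
congr (_ + _); rewrite -scaleNr; congr (_ *: _).
by rewrite rmorphM rmorphN rmorph_nat /= /u polyCM polyC_natr mulNr.
Qed.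

Lemma Lop_psi : actM (Lop F p) psi = 'X *: psi.
Proof.
rewrite act_Lop nab_psi /nab /psi /= (der0 derd) (der1 derd).
by congr pair; rewrite /= /GRing.scale /=; ring.
Qed.

(** The eigenvalue equation gives [m] the same second-order relation as [psi], so the iterated
    derivatives of both have the same coordinates. *)
Lemma iter_nab_eigen m i : actM (Lop F p) m = 'X *: m ->
  iter i nab m = (iter i nab psi).1 *: m + (iter i nab psi).2 *: nab m.
Proof.
rewrite act_Lop => /eqP; rewrite subr_eq -scalerDl => /eqP nab2.
elim: i => [|i IHi]; first by rewrite /= scale1r scale0r addr0.
rewrite iterS IHi nab_add !nab_scale nab2 iterS /nab -/(nab _) /=.
rewrite scalerA !scalerDl [_ *: nab m + _]addrC addrA.
by rewrite [_ * ('X + _)]mulrC -!addrA; congr (_ + _); rewrite addrCA.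
Qed.

(** [Phi] is the linear map sending [psi] to [m] and [nab psi] to [nab m]. It carries iterated
    derivatives of [psi] to those of [m], hence [A psi] to [A m]. *)
Lemma act_eigen A m : actM (Lop F p) m = 'X *: m ->
  actM A m = (actM A psi).1 *: m + (actM A psi).2 *: nab m.
Proof.
move=> Lm; pose Phi (n : M) : M := n.1 *: m + n.2 *: nab m.
have PhiD n n' : Phi (n + n') = Phi n + Phi n'.
  by rewrite /Phi /= !scalerDl addrACA.
have Phi0 : Phi 0 = 0 by rewrite /Phi /= !scale0r addr0.
rewrite -/(Phi _) /act (big_morph Phi PhiD Phi0); apply: eq_bigr => i _.
by rewrite (iter_nab_eigen _ Lm) /Phi /= scalerDr !scalerA.
Qed.

(** Two derivatives amount to a factor lambda up to lower order: the leading power lambda^k sits on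
    psi in order 2k, and psi' has coefficient lambda^k plus lower powers in order 2k+1. This count
    makes [f] monic. *)
Lemma size_iter_nab k :
  [/\ (size (iter k.*2 nab psi).1 <= k.+1)%N, ((iter k.*2 nab psi).1)`_k = 1
    & (size (iter k.*2 nab psi).2 <= k)%N] /\
  [/\ (size (iter k.*2.+1 nab psi).1 <= k.+1)%N,
      (size (iter k.*2.+1 nab psi).2 <= k.+1)%N
    & ((iter k.*2.+1 nab psi).2)`_k = 1].
Proof.
have szX (q : {poly V}) n :
    (size q <= n)%N -> (size (('X + u%:P) * q)%R <= n.+1)%N.
  move=> sq; apply: leq_trans (size_polyMleq _ _) _.
  by rewrite size_XaddC; lia.
have szD (q r : {poly V}) n : (size q <= n)%N -> (size r <= n)%N ->
    (size (q + r)%R <= n)%N.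
  by move=> sq sr; apply: leq_trans (size_polyD _ _) _; rewrite geq_max sq.
have szd (q : {poly V}) n : (size q <= n)%N -> (size (d q) <= n)%N.
  exact: size_der.
have coefXu (q : {poly V}) n : (size q <= n.+1)%N ->
    (('X + u%:P) * q)`_n.+1 = q`_n.
  move=> sq; rewrite mulrDl coefD coefXM coefCM /= (nth_default _ sq).
  by rewrite mulr0 addr0.
have odd_step (s t : {poly V}) n :
    [/\ (size s <= n.+1)%N, s`_n = 1 & (size t <= n)%N] ->
    [/\ (size (nab (s, t)).1 <= n.+1)%N, (size (nab (s, t)).2 <= n.+1)%N
      & ((nab (s, t)).2)`_n = 1].
  move=> [ss sn st]; split; rewrite /nab /=.
  - by apply: szD; [exact: szd | exact: szX].
  - by apply: szD => //; apply: szd; exact: leqW.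
  by rewrite coefD sn nth_default ?addr0 // szd.
elim: k => [|k [_ ]].
  have s0 : [/\ (size (1%R : {poly V}) <= 1)%N, (1 : {poly V})`_0 = 1
              & (size (0%R : {poly V}) <= 0)%N].
    by rewrite size_poly1 size_poly0 coef1.
  by split; [exact: s0 | exact: odd_step].
rewrite doubleS -[iter _.+3 _ _]/(nab (nab (iter k.*2.+1 nab psi))).
rewrite -[iter _.+2 _ _]/(nab (iter k.*2.+1 nab psi)).
case: (iter k.*2.+1 nab psi) => s t [ss st tk]; rewrite /= in ss st tk.
have even : [/\ (size (nab (s, t)).1 <= k.+2)%N, ((nab (s, t)).1)`_k.+1 = 1
              & (size (nab (s, t)).2 <= k.+1)%N].
  split; rewrite /nab /=.
  - by apply: szD; [apply: szd; exact: leqW | exact: szX].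
  - by rewrite coefD coefXu // tk nth_default ?add0r // szd.
  by apply: szD => //; exact: szd.
by move: even; case: (nab (s, t)) => s' t' even; split=> //; exact: odd_step.
Qed.

Lemma spectral_solution S : is_spectral p S ->
  exists f : {poly V},
    [/\ (size f <= p.+1)%N, f`_p = 1
      & f * d (d f) - hf%:P * d f ^+ 2 - 2%:R * ('X + u%:P) * f ^+ 2
        = - 2%:R * map_poly (fun k => pi (kW k)) S].
Proof.
case=> _ [_ [A [szA Alead comm sqA]]].
pose phi := actM A psi; exists phi.2.
have actM_eq B C m : eqop B C -> actM B m = actM C m.
  by move=> eqBC; apply: act_eq => i /=; rewrite (pi_eqV (eqBC i)).
have opM B C m : actM (opmul B C) m = actM B (actM C m).
  exact: (act_opmul tau_der nab_add nab_scale).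
have Lphi : actM (Lop F p) phi = 'X *: phi.
  rewrite -opM -(actM_eq _ _ _ comm) opM Lop_psi.
  by rewrite (actZ tau nab_scale) //; exact: der_polyX.
have Spsi : actM (polyop S (Lop F p)) psi
    = map_poly (fun k => pi (kW k)) S *: psi.
  rewrite (act_polyop derd tau_der nab_add nab_scale _ (der_polyX derD) Lop_psi).
  rewrite /map_poly poly_def; congr (_ *: _); apply: eq_bigr => i _.
  by rewrite mul_polyC.
have szt i : (size (iter i nab psi).2 <= uphalf i)%N.
  rewrite -[i in iter i]odd_double_half uphalf_half.
  by have [[_ _ ?] [_ ? _]] := size_iter_nab i./2; case: odd.
have phi2 : phi.2 = \sum_(i < (2 * p + 1).+1) tau A`_i * (iter i nab psi).2.
  rewrite /phi /act szA addn2 addn1.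
  exact: (raddf_sum (@snd {poly V}^o {poly V}^o)).
have szphi : (size phi.2 <= p.+1)%N.
  rewrite phi2; apply: leq_trans (size_sum _ _ _) _; apply/bigmax_leqP => i _.
  rewrite /= mul_polyC; apply: leq_trans (size_scale_leq _ _) _.
  by apply: leq_trans (szt i) _; have := ltn_ord i; rewrite uphalf_half; lia.
(* Derivatives of order below 2p+1 have a psi'-component of degree less than p, so only the leading
   coefficient 1 of [A] reaches lambda^p. *)
have phi_p : (phi.2)`_p = 1.
  rewrite phi2 big_ord_recr coefD coef_sum big1 ?add0r => [|i _].
    rewrite /= (pi_eqV Alead) rmorph1 mul1r addn1 mul2n.
    by have [_ []] := size_iter_nab p.
  rewrite /= coefCM [X in _ * X]nth_default ?mulr0 //.
  apply: leq_trans (szt i) _.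
  by have := ltn_ord i; rewrite uphalf_half /=; lia.
have := actM_eq _ _ psi sqA; rewrite opM Spsi (act_eigen _ Lphi) -/phi.
case: phi szphi phi_p {Lphi phi2} => h f /= szf fp eqM.
(* [e1] and [e2] are the two components of A(A psi) = S psi, where A psi = h psi + f psi'. *)
have e1 : h * h + f * (d h + ('X + u%:P) * f) = map_poly (fun k => pi (kW k)) S.
  exact: etrans (congr1 fst eqM) (mulr1 _).
have e2 : h * f + f * (h + d f) = 0 by exact: etrans (congr1 snd eqM) (mulr0 _).
(* [V] is not assumed to be a domain; [f] can be cancelled because it is monic. *)
have lregf : GRing.lreg f.
  apply: monic_lreg; apply/eqP; rewrite /lead_coef; suff -> : size f = p.+1 by [].
  apply/eqP; rewrite eqn_leq szf; case: leqP => // /(nth_default 0).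
  by rewrite fp => /eqP; rewrite oner_eq0.
have df : d f = - 2%:R * h.
  apply: lregf; apply: (addrI (f * (2%:R * h))).
  transitivity (h * f + f * (h + d f)); first by ring.
  by rewrite e2; ring.
split=> //.
have hfP : 2%:R * hf%:P = 1 :> {poly V} by rewrite -polyC_natr -polyCM hf2.
have -> : d (d f) = - 2%:R * d h.
  by rewrite df mulNr (derN derd) (der_natM derd) mulNr.
transitivity (- 2%:R * (h * h + f * (d h + ('X + u%:P) * f))).
  rewrite df; transitivity (- 2%:R * (f * (d h + ('X + u%:P) * f))
    - 2%:R * (2%:R * hf%:P) * h ^+ 2); first by ring.
  by rewrite hfP; ring.
by congr (_ * _); rewrite -e1.
Qed.

End Spectral.

(** * Solutions polynomial in the Weierstrass function *)

Section WeierstrassPolynomials.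
Variables (K : comNzRingType) (a b hf : K).
Implicit Types g h : {poly K}.
Let w : {poly K} := 'X.
Let fw : {poly K} := 4%:R * w ^+ 3 - a%:P * w - b%:P.
Let ew : {poly K} := 6%:R * w ^+ 2 - (hf * a)%:P.

(* [d^2/dx^2] on polynomials in [w], where [w'^2 = fw] and [w'' = ew]. *)
Definition d2w g : {poly K} := fw * g^`()^`() + ew * g^`().

Lemma is_deriv_deriv : is_deriv (@deriv K).
Proof. by split=> f g; [exact: derivD | exact: derivM]. Qed.

Lemma size_deriv_le g n : (size g <= n.+1)%N -> (size g^`() <= n)%N.
Proof.
move=> sg; apply/leq_sizeP => j le_nj; rewrite coef_deriv nth_default ?mul0rn //.
exact: leq_trans sg _.
Qed.

Lemma size_fw : (size (fw) <= 4)%N.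
Proof.
apply/leq_sizeP => j le4j; rewrite /fw /w -(polyC_natr _ 4).
rewrite !coefB !coefCM coefXn coefX coefC.
by case: j le4j => [|[|[|[|j]]]] //; rewrite !mulr0 !subr0.
Qed.

Lemma size_ew : (size (ew) <= 3)%N.
Proof.
apply/leq_sizeP => j le3j; rewrite /ew /w -(polyC_natr _ 6).
rewrite !coefB !coefCM coefXn coefC.
by case: j le3j => [|[|[|j]]] //; rewrite !mulr0 !subr0.
Qed.

Lemma size_mul_le g h m n : (size g <= m.+1)%N -> (size h <= n)%N ->
  (size (g * h)%R <= m + n)%N.
Proof.
move=> sg; have [->|h0 sh] := eqVneq h 0; first by rewrite mulr0 size_poly0.
by apply: leq_trans (size_polyMleq _ _) _; rewrite -size_poly_gt0 in h0; lia.
Qed.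

(** [fw] has degree 3 and meets a second derivative, [ew] has degree 2 and meets a first one: the
    degree grows by at most one. *)
Lemma size_d2w g n : (size g <= n.+1)%N -> (size (d2w g) <= n.+2)%N.
Proof.
move=> /size_deriv_le sg; apply: leq_trans (size_polyD _ _) _.
rewrite geq_max (leq_trans (size_mul_le size_ew sg)) ?andbT; last by lia.
case: n sg => [|n] sg.
  move: sg; rewrite size_poly_leq0 => /eqP ->.
  by rewrite deriv0 mulr0 size_poly0.
by rewrite (leq_trans (size_mul_le size_fw (size_deriv_le sg))) //; lia.
Qed.

Lemma size_fw_deriv g h m n : (size g <= m.+1)%N -> (size h <= n.+1)%N ->
  (size (fw * (g^`() * h^`()))%R <= (m + n).+2)%N.
Proof.
move=> /size_deriv_le sg /size_deriv_le sh.
case: m sg => [|m] sg.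
  move: sg; rewrite size_poly_leq0 => /eqP ->.
  by rewrite mul0r mulr0 size_poly0.
by apply: leq_trans (size_mul_le size_fw (size_mul_le sg sh)) _; lia.
Qed.

Lemma deriv_fw : (fw)^`() = 12%:R * w ^+ 2 - a%:P.
Proof.
rewrite /fw /w !derivB -(polyC_natr _ 4) !deriv_mulC derivC derivX derivXn.
by rewrite polyC_natr -mulr_natl /=; ring.
Qed.

(** Only 4 w^3 in [fw] and 6 w^2 in [ew] reach degree n + 1, with total factor 4 n (n - 1) + 6 n. *)
Lemma coef_d2w g n : (size g <= n.+1)%N ->
  (d2w g)`_n.+1 = (4 * n * n + 2 * n)%:R * g`_n.
Proof.
move=> sg.
have g0 j : (n < j)%N -> g`_j = 0.
  by move=> ltnj; rewrite nth_default ?(leq_trans sg).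
rewrite /d2w /fw /ew /w coefD -(polyC_natr _ 4) -(polyC_natr _ 6).
rewrite !mulrBl -!mulrA !coefB !coefCM !coefXM !coef_deriv /=.
rewrite (g0 n.+2) ?(g0 n.+3) ?ltnS ?leqnSn ?leqW // !mul0rn !mulr0 !subr0.
case: n {sg} g0 => [|[|n]] _ /=; first by rewrite !mulr0 addr0 mul0r.
  by rewrite mulr0 add0r.
by rewrite !mulr_natl -!mulrnA -mulrnDr; congr (_ *+ _); lia.
Qed.

Section Leading.
Variables (p : nat) (beta : nat -> {poly K}).
Hypothesis hf2 : 2%:R * hf = 1.
Hypothesis beta0 : beta 0%N = 1.
Hypothesis size_beta : forall n, (size (beta n) <= n.+1)%N.
Hypothesis eq_beta : forall n,
  smul beta (d2w \o beta) n
  - hf%:P * fw * smul (@deriv _ \o beta) (@deriv _ \o beta) n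
  - 2%:R * ((p * p.+1)%:R * w) * smul beta beta n
  - 2%:R * smul beta beta n.+1 = 0.

Lemma half_polyC : 2%:R * hf%:P = 1 :> {poly K}.
Proof. by rewrite -polyC_natr -polyCM hf2. Qed.

(** This is w'^2 = [fw] differentiated in x and divided by 2 w'. *)
Lemma half_deriv_fw : hf%:P * (fw)^`() = ew.
Proof.
rewrite deriv_fw /ew polyCM.
transitivity (6%:R * (2%:R * hf%:P) * w ^+ 2 - hf%:P * a%:P).
  by ring.
by rewrite half_polyC; ring.
Qed.

(* The derivative of the quadratic equation is [beta] times this linear one. *)
Lemma linear_beta n :
  (d2w (beta n))^`() - 4%:R * ((p * p.+1)%:R * w) * (beta n)^`()
  - 2%:R * (p * p.+1)%:R * beta n - 4%:R * (beta n.+1)^`() = 0.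
Proof.
(* [E] is the left-hand side of the linear equation as a series. Its convolution with [beta] is the
   derivative of the quadratic equation, and [beta] has constant term 1. *)
pose E m : {poly K} := (d2w (beta m))^`()
  - 4%:R * ((p * p.+1)%:R * w) * (beta m)^`()
  - 2%:R * (p * p.+1)%:R * beta m - 4%:R * (beta m.+1)^`().
apply: (@smul_eq0 _ beta E) => // m.
pose b' := @deriv _ \o beta; pose b'' := @deriv _ \o b'.
have dsm (c d : nat -> {poly K}) k : (smul c d k)^`() =
    smul (@deriv _ \o c) d k + smul c (@deriv _ \o d) k.
  exact: (der_smul (is_deriv_deriv)).
have E1 : smul b' (d2w \o beta) m = fw * smul b' b'' m + ew * smul b' b' m.
  by rewrite -!smulZr -smulDr.
(* The boundary term vanishes because [beta 0] is the constant 1. *)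
have E2 : smul beta b' m.+1 = smul beta (fun i => (beta i.+1)^`()) m.
  rewrite smulSr [b' 0%N](_ : _ = 0) ?mulr0 ?addr0 //.
  by rewrite /b' /= beta0 -polyC1 derivC.
have := congr1 (@deriv _) (eq_beta m).
rewrite deriv0 !derivB !derivM !dsm -/b' -/b'' -/b' E1.
rewrite !(smulC b' beta) (smulC b'' b') E2 derivC.
rewrite !(der_nat is_deriv_deriv) derivX.
move=> E3; rewrite !smulBr !smulZr -[RHS]E3 -half_deriv_fw.
(* The two sides differ by a multiple of [1 - 2%:R * hf], which is zero. *)
transitivity (smul beta (@deriv _ \o (d2w \o beta)) m
  - 4%:R * ((p * p.+1)%:R * w) * smul beta b' m
  - 2%:R * (p * p.+1)%:R * smul beta beta m
  - 4%:R * smul beta (fun i => (beta i.+1)^`()) m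
  + (1 - 2%:R * hf%:P) * fw * smul b' b'' m).
  by rewrite half_polyC subrr !mul0r addr0.
by ring.
Qed.

(** This is the coefficient of w^n in the linear equation; the degree bounds leave only leading
    coefficients. The two terms in p(p+1) combine with factor 4 n + 2. *)
Lemma lead_rec n : 4%:R * n.+1%:R * (beta n.+1)`_n.+1 =
  ((n.+1 * (4 * n * n + 2 * n))%:R - (2 * (p * p.+1) * (2 * n).+1)%:R)
  * (beta n)`_n.
Proof.
have := congr1 (fun q : {poly K} => q`_n) (linear_beta n).
rewrite coef0 !coefB coef_deriv coef_d2w // -!mulrA -!polyC_natr !coefCM.
rewrite [w]/('X) coefXM !coef_deriv.
have -> : (if n == 0%N then 0 else ((beta n)`_n.-1.+1 *+ n.-1.+1))
    = n%:R * (beta n)`_n.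
  by case: n => [|k]; rewrite ?mul0r // mulr_natl.
rewrite -(mulr_natl (_ * _) n.+1) -(mulr_natl (beta n.+1)`_n.+1 n.+1) => /eqP.
by rewrite subr_eq0 mulrA => /eqP <-; rewrite !natrM !mulrSr; ring.
Qed.

End Leading.
End WeierstrassPolynomials.

Lemma lead_neq0 (K : idomainType) (p : nat) (al : nat -> K) :
  (forall n, (0 < n)%N -> n%:R != 0 :> K) -> al 0%N = 1 ->
  (forall n, 4%:R * n.+1%:R * al n.+1 =
    ((n.+1 * (4 * n * n + 2 * n))%:R - (2 * (p * p.+1) * (2 * n).+1)%:R) * al n) ->
  forall n, (n <= p)%N -> al n != 0.
Proof.
move=> nat_neq0 al0 rec; elim=> [|n IHn] lt_np; first by rewrite al0 oner_eq0.
have := rec n; apply: contra_eq_neq => ->.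
rewrite mulr0 eq_sym mulf_neq0 ?IHn // ?(ltnW lt_np) //.
(* For n < p the truncated difference p(p+1) - n(n+1) is exact and positive, so the factor of [al n]
   is minus a positive integer. *)
have -> : (2 * (p * p.+1) * (2 * n).+1 =
  n.+1 * (4 * n * n + 2 * n) + 2 * (2 * n).+1 * (p * p.+1 - n * n.+1))%N.
  have : (n * n.+1 <= p * p.+1)%N by apply: leq_mul; lia.
  by nia.
rewrite natrD opprD addNKr oppr_eq0 nat_neq0 // muln_gt0 /= subn_gt0.
by apply: ltn_mul.
Qed.

Section PolynomialSolution.
Variables (K V : comNzRingType) (a b hf : K).
Variables (iota : {rmorphism {poly K} -> V}) (D : V -> V) (y : V) (p : nat).
Hypothesis iota_inj : injective iota.
Hypothesis derD : is_deriv D.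
Hypothesis hf2 : 2%:R * hf = 1.
Hypothesis D_iota : forall g, D (iota g) = iota g^`() * y.
Hypothesis yy : y * y =
  iota (4%:R * 'X ^+ 3 - a%:P * 'X - b%:P).
Hypothesis Dy : D y = iota (6%:R * 'X ^+ 2 - (hf * a)%:P).

Let h : V := iota hf%:P.
Let u : V := (p * p.+1)%:R * iota 'X.
Let one_ser (n : nat) : V := (n == 0)%N%:R.

Lemma iota_half : 2%:R * h = 1.
Proof. by rewrite -(rmorph_nat iota) -rmorphM half_polyC // rmorph1. Qed.

Lemma D2_iota g : D (D (iota g)) = iota (d2w a b hf g).
Proof.
rewrite !D_iota (der_mul derD) D_iota Dy -mulrA yy -!rmorphM -rmorphD.
by congr (iota _); rewrite /d2w; ring.
Qed.

Lemma DD_iota g g' : D (iota g) * D (iota g') =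
  iota ((4%:R * 'X ^+ 3 - a%:P * 'X - b%:P) * (g^`() * g'^`())).
Proof. by rewrite !D_iota mulrACA yy -!rmorphM mulrC. Qed.

Let isP n (v : V) := exists2 g : {poly K}, (size g <= n.+1)%N & v = iota g.

Lemma isP_add n v v' : isP n v -> isP n v' -> isP n (v + v').
Proof.
move=> [g sg ->] [g' sg' ->]; exists (g + g'); last by rewrite rmorphD.
by apply: leq_trans (size_polyD _ _) _; rewrite geq_max sg.
Qed.

Lemma isP_opp n v : isP n v -> isP n (- v).
Proof. by move=> [g sg ->]; exists (- g); rewrite ?size_polyN ?rmorphN. Qed.

Lemma isP_mul m n v v' : isP m v -> isP n v' -> isP (m + n) (v * v').
Proof.
move=> [g sg ->] [g' sg' ->]; exists (g * g'); last by rewrite rmorphM.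
by rewrite -addnS size_mul_le.
Qed.

Lemma isP_const n c : isP n (iota c%:P).
Proof. by exists c%:P => //; apply: leq_trans (size_polyC_leq1 _) _. Qed.

Lemma isP_nat n m : isP n m%:R.
Proof. by rewrite -(rmorph_nat iota) -polyC_natr; exact: isP_const. Qed.

Lemma isP_sum n (I : Type) (r : seq I) (P : pred I) (f : I -> V) :
  (forall i, P i -> isP n (f i)) -> isP n (\sum_(i <- r | P i) f i).
Proof.
move=> isPf; apply: (big_ind (isP n)) => //; first exact: (isP_nat n 0).
exact: isP_add.
Qed.

Lemma isP_scale n c v : isP 0 c -> isP n v -> isP n (c * v).
Proof. by move=> c0 vn; rewrite -[n]add0n; exact: isP_mul. Qed.

Variable B : nat -> V.
Hypothesis B0 : B 0%N = 1.
Hypothesis solB : solves D u h one_ser B.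

(** Every term of the recursion raises the degree in wp by at most one: [d2w] does so, in the
    product of first derivatives the cubic adds three while the derivatives remove two, and [u] is a
    multiple of wp. *)
Lemma isP_solution n : isP n (B n).
Proof.
elim/ltn_ind: n => -[|n] IHn; first by rewrite B0; exact: (isP_nat 0 1).
have hP : isP 0 h by exact: isP_const.
(* One [h] removes the factor 2 of the equation, the other the double occurrence of [B n.+1] in the
   convolution. *)
have eqB : B n.+1 = h * (h * eqK D u h B n - \sum_(i < n) B i.+1 * B (n - i)%N).
  have := solB.2 n; rewrite /one_ser mulr0 => /eqP; rewrite subr_eq0 => /eqP ->.
  rewrite mulrA [h * 2%:R]mulrC iota_half mul1r smulSr B0 mulr1 smulC /smul.
  rewrite big_ord_recr /= subnn B0 mulr1.
  transitivity (2%:R * h * B n.+1); first by rewrite iota_half mul1r.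
  by ring.
have isPBB m (f g : nat -> V) :
    (forall i j, (i + j = n)%N -> isP m (f i * g j)) -> isP m (smul f g n).
  by move=> fg; apply: isP_sum => i _; apply: fg; have := ltn_ord i; lia.
have IH i : (i <= n)%N -> isP i (B i) by move=> le_in; exact: IHn.
rewrite eqB; apply: isP_scale => //; apply: isP_add; last first.
  apply/isP_opp/isP_sum => i _; have := ltn_ord i => lt_in.
  have -> : n.+1 = (i.+1 + (n - i))%N by lia.
  by apply: isP_mul; apply: IHn; lia.
apply: isP_scale => //; apply: isP_add; first apply: isP_add.
- apply: isPBB => i j ijn; rewrite -ijn -addnS.
  apply: isP_mul; first by apply: IH; lia.
  have [|g sg /= ->] := IH j; first by lia.
  by rewrite D2_iota; exists (d2w a b hf g) => //; exact: size_d2w.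
- apply/isP_opp/isP_scale => //; apply: isPBB => i j ijn /=.
  have [|g sg ->] := IH i; first by lia.
  have [|g' sg' ->] := IH j; first by lia.
  rewrite DD_iota; eexists; last by [].
  by rewrite -ijn; exact: size_fw_deriv.
apply: isP_opp; rewrite -mulrA; apply: isP_scale; first exact: isP_nat.
rewrite -mulrA; apply: isP_scale; first exact: isP_nat.
rewrite -add1n; apply: isP_mul; first by exists 'X; rewrite ?size_polyX.
by apply: isPBB => i j ijn; rewrite -ijn; apply: isP_mul; apply: IH; lia.
Qed.

Lemma polynomial_solution : exists beta : nat -> {poly K},
  [/\ beta 0%N = 1, forall n, (size (beta n) <= n.+1)%N,
      forall n, B n = iota (beta n)
    & forall n, 4%:R * n.+1%:R * (beta n.+1)`_n.+1 =
  ((n.+1 * (4 * n * n + 2 * n))%:R - (2 * (p * p.+1) * (2 * n).+1)%:R)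
  * (beta n)`_n].
Proof.
(* The property is boolean, so [xchoose] selects the polynomials for all [n] at once. *)
have exB n : exists g : {poly K}, (size g <= n.+1)%N && (B n == iota g).
  by have [g sg ->] := isP_solution n; exists g; rewrite sg /=.
pose beta n := xchoose (exB n).
have sbeta n : (size (beta n) <= n.+1)%N.
  by have /andP[] := xchooseP (exB n).
have Bbeta n : B n = iota (beta n).
  by have /andP[_ /eqP] := xchooseP (exB n).
have beta0 : beta 0%N = 1 by apply: iota_inj; rewrite -Bbeta B0 rmorph1.
exists beta; split=> //; apply: lead_rec hf2 beta0 sbeta _ => n.
(* The equation in [V] is pulled back to polynomials through the injective [iota]. *)
apply: iota_inj; rewrite rmorph0.
have iota_smul f g : iota (smul f g n) = smul (iota \o f) (iota \o g) n.
  by rewrite /smul rmorph_sum; apply: eq_bigr => i _; rewrite rmorphM.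
have := solB.2 n; rewrite /one_ser mulr0 => <-.
rewrite /eqK.
have -> : smul (D \o B) (D \o B) n = iota ((4%:R * 'X ^+ 3 - a%:P * 'X - b%:P)
    * smul (@deriv _ \o beta) (@deriv _ \o beta) n).
  rewrite -smulZr iota_smul; apply: eq_bigr => i _ /=.
  by rewrite !Bbeta DD_iota -rmorphM; congr (iota _); ring.
have -> : smul B (D \o (D \o B)) n = iota (smul beta (d2w a b hf \o beta) n).
  by rewrite iota_smul; apply: eq_bigr => i _ /=; rewrite !Bbeta D2_iota.
have sBB m : smul B B m = iota (smul beta beta m).
  rewrite /smul rmorph_sum; apply: eq_bigr => i _ /=.
  by rewrite !Bbeta rmorphM.
rewrite !sBB !rmorphB /= -!mulrA !(rmorphM iota 2%:R) (rmorphM iota hf%:P).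
by rewrite (rmorphM iota (p * p.+1)%:R) !(rmorphM iota 'X) !rmorph_nat /u.
Qed.

End PolynomialSolution.

(** * The cases p = 1, 2, 3 *)

(* [A] plays [V[lambda]] and [x] plays [lambda]; to avoid fractions,
   [g2 = 4 e] and [g3 = 4 m]. *)
Section LameExplicit.
Variables (A : comNzRingType) (d : A -> A) (x w y e m h : A).
Hypothesis derd : is_deriv d.
Hypothesis h2 : 2%:R * h = 1.
Hypotheses (dx : d x = 0) (de : d e = 0) (dm : d m = 0).
Hypotheses (dw : d w = y) (dy : d y = 6%:R * w ^+ 2 - 2%:R * e).
Hypothesis yy : y * y = 4%:R * w ^+ 3 - 4%:R * e * w - 4%:R * m.

Lemma der_exp z n : d (z ^+ n.+1) = n.+1%:R * z ^+ n * d z.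
Proof.
elim: n => [|n IHn]; first by rewrite !mul1r.
by rewrite exprS (der_mul derd) IHn [in RHS]mulrSr exprS; ring.
Qed.

Let derE := (der_nat derd, der_exp, der_add derd, derN derd, der_mul derd,
  dx, de, dm, dw).

Definition lame_lhs N f : A :=
  f * d (d f) - h * d f ^+ 2 - 2%:R * (x + N * w) * f ^+ 2.

(** For [f] polynomial in [w], [q] and [q'] are its first two w-derivatives. Then [y] enters only
    through [y * y] and [d y], and the remaining identity is within reach of [ring]. *)
Lemma lame_lhsE N f q q' : d f = q * y -> d q = q' * y ->
  lame_lhs N f = f * (q' * (4%:R * w ^+ 3 - 4%:R * e * w - 4%:R * m)
                      + q * (6%:R * w ^+ 2 - 2%:R * e))
    - (2%:R * w ^+ 3 - 2%:R * e * w - 2%:R * m) * q ^+ 2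
    - 2%:R * (x + N * w) * f ^+ 2.
Proof.
move=> df dq; rewrite /lame_lhs df (der_mul derd) dq dy -mulrA yy.
congr (_ - _ - _); rewrite expr2 mulrACA yy.
transitivity (2%:R * h * (2%:R * w ^+ 3 - 2%:R * e * w - 2%:R * m) * q ^+ 2).
  by ring.
by rewrite h2 mul1r.
Qed.

Lemma lame1 : lame_lhs 2%:R (x - w) = - 2%:R * (x ^+ 3 - e * x - m).
Proof.
rewrite (@lame_lhsE _ _ (- 1) 0) ?derE; first by ring.
- by rewrite mulN1r add0r.
by rewrite -[1]/(1%:R) !derE; ring.
Qed.

Lemma lame2 : lame_lhs 6%:R (x ^+ 2 - 3%:R * w * x + 9%:R * w ^+ 2 - 9%:R * e)
  = - 2%:R * ((x ^+ 2 - 12%:R * e) * (x ^+ 3 - 9%:R * e * x + 27%:R * m)).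
Proof.
rewrite (@lame_lhsE _ _ (18%:R * w - 3%:R * x) 18%:R) ?derE; ring.
Qed.

(** The right-hand side has degree 7 in [x] and contains the factor [x], which cancels the lambda
    under the root; hence the radicand of degree 6 for p = 3. *)
Lemma lame3 : lame_lhs 12%:R (x ^+ 3 - 6%:R * w * x ^+ 2
    + 15%:R * (3%:R * w ^+ 2 - 4%:R * e) * x
    - 225%:R * w ^+ 3 + 225%:R * e * w + 225%:R * m)
  = - 2%:R * (x * (x ^+ 6 - 126%:R * e * x ^+ 4 + 594%:R * m * x ^+ 3
    + 4185%:R * e ^+ 2 * x ^+ 2 - 36450%:R * e * m * x
    - 13500%:R * e ^+ 3 + 91125%:R * m ^+ 2)).
Proof.
rewrite (@lame_lhsE _ _ (- 6%:R * x ^+ 2 + 90%:R * w * x - 675%:R * w ^+ 2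
  + 225%:R * e) (90%:R * x - 1350%:R * w)) ?derE; ring.
Qed.

End LameExplicit.

(** * Comparison of the rescaled series with polynomial solutions *)

Lemma rmorph_smul (A B : comNzRingType) (phi : {rmorphism A -> B}) f g n :
  phi (smul f g n) = smul (phi \o f) (phi \o g) n.
Proof. by rewrite /smul rmorph_sum; apply: eq_bigr => i _; rewrite rmorphM. Qed.

Lemma rmorph_revc (A B : comNzRingType) (phi : {rmorphism A -> B}) d f n :
  phi (revc d f n) = revc d (map_poly phi f) n.
Proof. by rewrite /revc coef_map; case: ifP => // _; rewrite rmorph0. Qed.

Lemma revc_scale (A : comNzRingType) c d (f : {poly A}) n :
  revc d (c%:P * f) n = c * revc d f n.
Proof. by rewrite /revc coefCM; case: ifP => // _; rewrite mulr0. Qed.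

Lemma revc_mulX (A : comNzRingType) d (f : {poly A}) n :
  revc d.+1 ('X * f) n = revc d f n.
Proof.
rewrite /revc coefXM; case: (ltngtP n d.+1) => [lt_n|lt_n|->].
- by rewrite -(ltnS n d) lt_n subSn.
- by rewrite leqNgt (ltnW lt_n).
by rewrite subnn ltnn.
Qed.

Section Normalisation.
Variables (K V : comNzRingType) (a b hf : K).
Variables (iota : {rmorphism {poly K} -> V}) (D : V -> V) (y : V).
Hypothesis derD : is_deriv D.
Hypothesis hf2 : 2%:R * hf = 1.
Hypothesis D_iota : forall g, D (iota g) = iota g^`() * y.
Hypothesis yy : y * y =
  iota (4%:R * 'X ^+ 3 - a%:P * 'X - b%:P).
Hypothesis Dy : D y = iota (6%:R * 'X ^+ 2 - (hf * a)%:P).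

Let h : V := iota hf%:P.
Let one_ser (n : nat) : V := (n == 0)%N%:R.
Let kap : {rmorphism K -> V} := iota \o polyC.

Variables (B : nat -> V) (r : nat -> K) (p : nat).
Hypothesis B0 : B 0%N = 1.
Hypothesis solB : solves D ((p * p.+1)%:R * iota 'X) h one_ser B.
Hypothesis r0 : r 0%N = 1.

Lemma D_kap k : D (kap k) = 0.
Proof. by rewrite D_iota derivC rmorph0 mul0r. Qed.

(** Both series start with 1 and solve the equation whose right-hand side is the expansion of [S]:
    one by rescaling [B], the other by reversing [f]. Uniqueness identifies them. *)
Lemma normalised_solution (f S : {poly V}) : (size f <= p.+1)%N -> f`_p = 1 ->
  f * map_poly D (map_poly D f) - h%:P * map_poly D f ^+ 2
    - 2%:R * ('X + ((p * p.+1)%:R * iota 'X)%:P) * f ^+ 2 = - 2%:R * S ->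
  (forall n, kap (smul r r n) = revc (2 * p + 1) S n) ->
  forall n, smul (kap \o r) B n = revc p f n.
Proof.
move=> sf fp eqS sqS.
have h2 : 2%:R * h = 1 by exact: iota_half.
have [solf0 solf] := solves_revc derD h2 sf eqS.
(* [one_ser] is the unit for convolution. *)
have ser1 n : smul (smul (kap \o r) (kap \o r)) one_ser n = revc (p + p).+1 S n.
  rewrite addnn -mul2n -addn1 -sqS rmorph_smul {1}/smul big_ord_recr /= subnn.
  rewrite mulr1 big1 ?add0r // => i _.
  by rewrite /one_ser subn_eq0 leqNgt ltn_ord mulr0.
have [sol0 sol] := solves_scale derD (fun i => D_kap (r i)) solB.
apply: (solves_inj h2 (s := revc (p + p).+1 S)) => //.
- by rewrite smul0 /= r0 rmorph1 B0 mul1r.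
- by rewrite /revc subn0.
- by split=> [|n]; rewrite -ser1.
Qed.

Let w : {poly V} := (iota 'X)%:P.
(** As [h] is one half, [e] and [m] are the quarters of the invariants [a] and [b], matching the
    variables of [lame1], [lame2] and [lame3]. *)
Let e : {poly V} := (h ^+ 2 * kap a)%:P.
Let m : {poly V} := (h ^+ 2 * kap b)%:P.
Let d := map_poly D.

Lemma half_unit : 2%:R * h = 1. Proof. exact: iota_half. Qed.

Lemma quarter_unit : 4%:R * h ^+ 2 = 1.
Proof.
by transitivity ((2%:R * h) ^+ 2); [ring | rewrite half_unit expr1n].
Qed.

Lemma four_e : (kap a)%:P = 4%:R * e.
Proof. by rewrite /e -polyC_natr -polyCM mulrA quarter_unit mul1r. Qed.

Lemma four_m : (kap b)%:P = 4%:R * m.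
Proof. by rewrite /m -polyC_natr -polyCM mulrA quarter_unit mul1r. Qed.

Lemma half_polyV : 2%:R * h%:P = 1 :> {poly V}.
Proof. by rewrite -polyC_natr -polyCM half_unit. Qed.

Lemma d_kap k : d (kap k)%:P = 0.
Proof. by rewrite /d (der_polyC derD) D_kap. Qed.

Lemma d_e : d e = 0.
Proof. by rewrite -(d_kap (hf ^+ 2 * a)) (rmorphM kap) (rmorphXn kap). Qed.

Lemma d_m : d m = 0.
Proof. by rewrite -(d_kap (hf ^+ 2 * b)) (rmorphM kap) (rmorphXn kap). Qed.

Lemma d_w : d w = y%:P.
Proof. by rewrite /d (der_polyC derD) D_iota derivX rmorph1 mul1r. Qed.

Lemma d_y : d y%:P = 6%:R * w ^+ 2 - 2%:R * e.
Proof.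
rewrite /d (der_polyC derD) Dy rmorphB polyCB; congr (_ - _).
  by rewrite (rmorphM iota 6%:R) rmorph_nat rmorphXn polyCM polyC_natr polyC_exp.
rewrite !rmorphM -/(kap a) -/h /= four_e mulrA [_ * 4%:R](_ : _ = 2%:R) //.
transitivity (2%:R * (2%:R * h%:P)); first by ring.
by rewrite half_polyV mulr1.
Qed.

Lemma y_y : y%:P * y%:P = 4%:R * w ^+ 3 - 4%:R * e * w - 4%:R * m.
Proof.
rewrite -polyCM yy !rmorphB /= -four_e -four_m; congr (_ - _ - _).
  by rewrite (rmorphM iota 4%:R) rmorph_nat rmorphXn polyCM polyC_natr polyC_exp.
by rewrite rmorphM polyCM.
Qed.

Let lame := lame_lhs d 'X w h%:P.

(** [c] and [H] invert the leading coefficients of numerator and radicand, which reduces the claim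
    to the normalised case. *)
Lemma explicit_solution (c H : V) (N : seq {poly K}) (l : K) (S : {poly K}) :
  size N = p.+1 -> c * iota N`_p = 1 -> H * kap (l ^+ 2) = 1 ->
  lame (p * p.+1)%:R (c%:P * map_poly iota (Poly N))
    = - 2%:R * (H%:P * map_poly kap S) ->
  (forall n, l ^+ 2 * smul r r n = revc (2 * p + 1) S n) ->
  forall n, smul (kap \o r) B n = c * iota (revc p (Poly N) n).
Proof.
move=> sN cN Hl eqS sqS n; rewrite rmorph_revc -revc_scale.
apply: (normalised_solution (S := H%:P * map_poly kap S)) => [|||i].
- apply/leq_sizeP => j lt_pj; rewrite coefCM coef_map coef_Poly.
  by rewrite [N`_j]nth_default ?sN // raddf0 mulr0.
- by rewrite coefCM coef_map coef_Poly.
- by rewrite -eqS /lame /lame_lhs /w polyCM polyC_natr.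
by rewrite revc_scale -rmorph_revc -sqS (rmorphM kap) mulrA Hl mul1r.
Qed.

Lemma map_Poly_cons (A C : nzRingType) (phi : {rmorphism A -> C}) t s :
  map_poly phi (Poly (t :: s)) = map_poly phi (Poly s) * 'X + (phi t)%:P.
Proof. by rewrite /= cons_poly_def rmorphD rmorphM /= map_polyX map_polyC. Qed.

Lemma map_Poly_nil (A C : nzRingType) (phi : {rmorphism A -> C}) :
  map_poly phi (Poly [::]) = 0.
Proof. by rewrite /= rmorph0. Qed.

Lemma map_polyM (A C : nzRingType) (phi : {rmorphism A -> C}) f g :
  map_poly phi (f * g) = map_poly phi f * map_poly phi g.
Proof. exact: rmorphM. Qed.

(* The coefficients are variables because matching would evaluate the literals
   of [D3] in unary. *)
Lemma map_Poly_sextic (A C : comNzRingType) (phi : {rmorphism A -> C})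
    n1 n2 n3 n4 n5 n6 n7 s t :
  map_poly phi (Poly [:: - (n1%:R * s ^+ 3) + n2%:R * t ^+ 2;
    - (n3%:R * s * t); n4%:R * s ^+ 2; n5%:R * t; - (n6%:R * s); 0; n7%:R])
  = n7%:R * 'X ^+ 6 - n6%:R * (phi s)%:P * 'X ^+ 4
    + n5%:R * (phi t)%:P * 'X ^+ 3 + n4%:R * (phi s)%:P ^+ 2 * 'X ^+ 2
    - n3%:R * (phi s)%:P * (phi t)%:P * 'X - n1%:R * (phi s)%:P ^+ 3
    + n2%:R * (phi t)%:P ^+ 2.
Proof.
rewrite !map_Poly_cons map_Poly_nil rmorphD !(rmorphN phi) !(rmorphM phi).
rewrite !(rmorph_nat phi) (rmorph0 phi).
by rewrite !(polyC_natr, polyCN, polyCD, polyCM, polyC0); ring.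
Qed.

Lemma quarter_polyV : 4%:R * (h ^+ 2)%:P = 1 :> {poly V}.
Proof. by rewrite -polyC_natr -polyCM quarter_unit. Qed.

Lemma quarter_kap : h ^+ 2 * kap (2%:R ^+ 2) = 1.
Proof.
rewrite rmorphXn rmorph_nat; transitivity (4%:R * h ^+ 2); first by ring.
exact: quarter_unit.
Qed.

Let X : {poly K} := 'X.

Lemma explicit1 : p = 1%N ->
  (forall n, 2%:R ^+ 2 * smul r r n = revc 3 (Poly [:: - b; - a; 0; 4%:R]) n) ->
  forall n, smul (kap \o r) B n = iota (revc 1 (Poly [:: - X; 1]) n).
Proof.
move=> p1 sqS n; rewrite -[RHS]mul1r.
have eqN : 1%:P * map_poly iota (Poly [:: - X; 1]) = 'X - w.
  rewrite !map_Poly_cons map_Poly_nil (rmorph1 iota) rmorphN polyCN polyC1 /w /X.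
  by ring.
have eqS : (h ^+ 2)%:P * map_poly kap (Poly [:: - b; - a; 0; 4%:R])
    = 'X ^+ 3 - e * 'X - m.
  rewrite !map_Poly_cons map_Poly_nil !(rmorphN kap) (rmorph0 kap).
  rewrite (rmorph_nat kap) !polyCN four_e four_m polyC_natr polyC0.
  transitivity (4%:R * (h ^+ 2)%:P * ('X ^+ 3 - e * 'X - m)); first by ring.
  by rewrite quarter_polyV mul1r.
have := @explicit_solution 1 (h ^+ 2) [:: - X; 1] 2%:R
  (Poly [:: - b; - a; 0; 4%:R]).
rewrite p1 => /(_ erefl); apply => //.
- by rewrite rmorph1 mul1r.
- exact: quarter_kap.
rewrite eqN eqS.
  exact: (lame1 (is_deriv_map derD) half_polyV (der_polyX derD)
    d_w d_y y_y).
Qed.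

Lemma explicit2 : p = 2%N ->
  (forall n, 2%:R ^+ 2 * smul r r n = revc 5
     (Poly [:: - (3%:R * a); 0; 1]
      * Poly [:: 27%:R * b; - (9%:R * a); 0; 4%:R]) n) ->
  forall n, smul (kap \o r) B n = h ^+ 2 * iota (revc 2
    (Poly [:: 36%:R * X ^+ 2 - 9%:R * a%:P; - (12%:R * X); 4%:R]) n).
Proof.
move=> p2 sqS n.
have eqN : (h ^+ 2)%:P * map_poly iota
    (Poly [:: 36%:R * X ^+ 2 - 9%:R * a%:P; - (12%:R * X); 4%:R])
    = 'X ^+ 2 - 3%:R * w * 'X + 9%:R * w ^+ 2 - 9%:R * e.
  rewrite !map_Poly_cons map_Poly_nil (rmorphB iota) (rmorphN iota).
  rewrite !(rmorphM iota _%:R) !(rmorph_nat iota) (rmorphXn iota).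
  rewrite polyCB polyCN !polyCM !polyC_natr.
  rewrite /X -/w four_e.
  transitivity (4%:R * (h ^+ 2)%:P
    * ('X ^+ 2 - 3%:R * w * 'X + 9%:R * w ^+ 2 - 9%:R * e)); first by ring.
  by rewrite quarter_polyV mul1r.
have eqS : (h ^+ 2)%:P * map_poly kap (Poly [:: - (3%:R * a); 0; 1]
      * Poly [:: 27%:R * b; - (9%:R * a); 0; 4%:R])
    = ('X ^+ 2 - 12%:R * e) * ('X ^+ 3 - 9%:R * e * 'X + 27%:R * m).
  rewrite map_polyM !map_Poly_cons !map_Poly_nil !(rmorphN kap) !(rmorphM kap).
  rewrite !(rmorph0 kap) (rmorph1 kap) !(rmorph_nat kap).
  rewrite !polyCN !polyCM !polyC_natr polyC0 polyC1 four_e four_m.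
  transitivity (4%:R * (h ^+ 2)%:P
    * (('X ^+ 2 - 12%:R * e) * ('X ^+ 3 - 9%:R * e * 'X + 27%:R * m))); first by ring.
  by rewrite quarter_polyV mul1r.
(* Numerator and radicand both have leading coefficient 4, inverted by [h ^+ 2]. *)
have := @explicit_solution (h ^+ 2) (h ^+ 2)
  [:: 36%:R * X ^+ 2 - 9%:R * a%:P; - (12%:R * X); 4%:R] 2%:R
  (Poly [:: - (3%:R * a); 0; 1] * Poly [:: 27%:R * b; - (9%:R * a); 0; 4%:R]).
rewrite p2 => /(_ erefl); apply => //.
- by rewrite /= rmorph_nat mulrC quarter_unit.
- exact: quarter_kap.
rewrite eqN eqS.
  exact: (lame2 (is_deriv_map derD) half_polyV (der_polyX derD)
    d_e d_w d_y y_y).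
Qed.

Lemma explicit3 : p = 3%N ->
  (forall n, 4%:R ^+ 2 * smul r r n = revc 6
     (Poly [:: - (3375%:R * a ^+ 3) + 91125%:R * b ^+ 2; - (36450%:R * a * b);
           4185%:R * a ^+ 2; 2376%:R * b; - (504%:R * a); 0; 16%:R]) n) ->
  forall n, smul (kap \o r) B n = h ^+ 2 * iota (revc 3
    (Poly [:: - (900%:R * X ^+ 3) + 225%:R * a%:P * X + 225%:R * b%:P;
           60%:R * (3%:R * X ^+ 2 - a%:P); - (24%:R * X); 4%:R]) n).
Proof.
set D3 := Poly _; set N3 := [:: - (900%:R * _) + _ + _; _; _; _].
move=> p3 sqS n.
have eqN : (h ^+ 2)%:P * map_poly iota (Poly N3)
  = 'X ^+ 3 - 6%:R * w * 'X ^+ 2 + 15%:R * (3%:R * w ^+ 2 - 4%:R * e) * 'X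
    - 225%:R * w ^+ 3 + 225%:R * e * w + 225%:R * m.
  rewrite !map_Poly_cons map_Poly_nil !(rmorphN iota, rmorphB iota, rmorphD iota).
  rewrite (rmorphM iota (225%:R * _)) !(rmorphM iota _%:R).
  rewrite !(rmorph_nat iota) !(rmorphXn iota).
  rewrite (rmorphB iota) !(rmorphM iota _%:R) !(rmorph_nat iota) !(rmorphXn iota).
  rewrite !(polyC_natr, polyCN, polyCD, polyCM) /X -/w four_e four_m.
  transitivity (4%:R * (h ^+ 2)%:P * ('X ^+ 3 - 6%:R * w * 'X ^+ 2
    + 15%:R * (3%:R * w ^+ 2 - 4%:R * e) * 'X
    - 225%:R * w ^+ 3 + 225%:R * e * w + 225%:R * m)); first by ring.
  by rewrite quarter_polyV mul1r.
have eqS : (h ^+ 4)%:P * map_poly kap ('X * D3)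
    = 'X * ('X ^+ 6 - 126%:R * e * 'X ^+ 4 + 594%:R * m * 'X ^+ 3
    + 4185%:R * e ^+ 2 * 'X ^+ 2 - 36450%:R * e * m * 'X
    - 13500%:R * e ^+ 3 + 91125%:R * m ^+ 2).
  rewrite map_polyM map_polyX /D3 map_Poly_sextic four_e four_m.
  transitivity ((4%:R * (h ^+ 2)%:P) ^+ 2 * ('X * ('X ^+ 6
    - 126%:R * e * 'X ^+ 4 + 594%:R * m * 'X ^+ 3
    + 4185%:R * e ^+ 2 * 'X ^+ 2 - 36450%:R * e * m * 'X
    - 13500%:R * e ^+ 3 + 91125%:R * m ^+ 2))).
    by rewrite !polyC_exp; ring.
  by rewrite quarter_polyV expr1n mul1r.
(* The leading coefficient 16 of the radicand is inverted by [h ^+ 4]. The factor ['X] raises its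
   degree to 2p + 1 = 7 without changing the expansion. *)
have := @explicit_solution (h ^+ 2) (h ^+ 4) N3 4%:R ('X * D3).
rewrite p3 => /(_ erefl); apply => //.
- by rewrite /= rmorph_nat mulrC quarter_unit.
- rewrite rmorphXn rmorph_nat; transitivity ((4%:R * h ^+ 2) ^+ 2); first by ring.
  by rewrite quarter_unit expr1n.
- rewrite eqN eqS.
  exact: (lame3 (is_deriv_map derD) half_polyV (der_polyX derD)
    d_e d_m d_w d_y y_y).
by move=> i; rewrite revc_mulX.
Qed.

End Normalisation.

(** * The ring of polynomials in wp and wp' *)

Section Quotient.
Variables (P : comNzRingType) (rel : {poly P}) (dW : {poly P} -> {poly P}).
Hypothesis rel_monic : rel \is monic.
Hypothesis size_rel : (1 < size rel)%N.
Hypothesis derW : is_deriv dW.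
Hypothesis dW_rel : dW rel = 0.

Local Notation Q := {poly %/ rel}.
Local Notation proj := (in_qpoly rel).

Definition quot_der (v : Q) : Q := proj (dW (val v)).

(** The quotient is taken by [mk_monic rel], which replaces [rel] by a default unless it is monic
    and nonconstant. *)
Lemma mk_rel : mk_monic rel = rel.
Proof. by rewrite /mk_monic size_rel rel_monic. Qed.

Lemma proj_rel q : proj (q * rel) = 0.
Proof.
by apply: val_inj; rewrite /= mk_rel Pdiv.RingMonic.rmodp_mull.
Qed.

Lemma proj_eqP f g : proj f = proj g <-> exists q, f - g = q * rel.
Proof.
split=> [eq_fg|[q fgq]]; last first.
  by apply/eqP; rewrite -subr_eq0 -rmorphB /= fgq proj_rel.
exists (Pdiv.Ring.rdivp (f - g) rel).
rewrite [LHS](Pdiv.RingMonic.rdivp_eq rel_monic).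
suff /(congr1 val) : proj (f - g) = 0 by rewrite /= mk_rel => ->; rewrite addr0.
by rewrite rmorphB /= eq_fg subrr.
Qed.

Lemma proj_val v : proj (val v) = v.
Proof.
by apply: val_inj; rewrite /= Pdiv.Ring.rmodp_small // size_mk_monic.
Qed.

(** [quot_der] does not depend on the representative: two of them differ by a multiple [q * rel],
    whose derivative is [dW q * rel] because [dW rel = 0]. *)
Lemma proj_der h : proj (dW h) = quot_der (proj h).
Proof.
have /proj_eqP[q hq] : proj h = proj (val (proj h)) by rewrite proj_val.
apply/proj_eqP; exists (dW q).
by rewrite -(derB derW) hq (der_mul derW) dW_rel mulr0 addr0.
Qed.

Lemma is_deriv_quot : is_deriv quot_der.
Proof.
split=> f g; rewrite -[f]proj_val -[g]proj_val.
  by rewrite -rmorphD -!proj_der (der_add derW) rmorphD.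
by rewrite -rmorphM -!proj_der (der_mul derW) rmorphD !rmorphM.
Qed.

(** Constants have degree below that of [rel], so they are their own remainders. *)
Lemma proj_polyC_inj : injective (proj \o polyC).
Proof.
move=> c c' /(congr1 val) /=; rewrite mk_rel.
by rewrite !Pdiv.Ring.rmodp_small ?(leq_ltn_trans (size_polyC_leq1 _)) // => /polyC_inj.
Qed.

End Quotient.

Section Extension.
Variables (P : comNzRingType) (dl : P -> P) (c e : P).
Hypothesis derdl : is_deriv dl.

Definition ext_der (h : {poly P}) := map_poly dl h * 'X + h^`() * e%:P.

Lemma is_deriv_ext : is_deriv ext_der.
Proof.
have [D1 M1] := is_deriv_map derdl; split=> f g; rewrite /ext_der.
  by rewrite D1 derivD; ring.
by rewrite M1 derivM; ring.
Qed.

Lemma ext_der_polyC g : ext_der g%:P = (dl g)%:P * 'X.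
Proof. by rewrite /ext_der (der_polyC derdl) derivC mul0r addr0. Qed.

Lemma ext_der_polyX : ext_der 'X = e%:P.
Proof. by rewrite /ext_der (der_polyX derdl) derivX mul0r mul1r add0r. Qed.

(** With y for the variable, the derivative of y^2 - c is (2 e - dl c) y. *)
Lemma ext_der_rel : dl c = 2%:R * e -> ext_der ('X ^+ 2 - c%:P) = 0.
Proof.
move=> dlc; rewrite (derB is_deriv_ext) expr2 (der_mul is_deriv_ext).
by rewrite ext_der_polyX ext_der_polyC dlc polyCM polyC_natr; ring.
Qed.

End Extension.

Section Weierstrass.
Variable F : fieldType.
Hypothesis HF : [pchar F] =i pred0.

Lemma natK_neq0 n : (0 < n)%N -> n%:R != 0 :> Kp F.
Proof. by rewrite -!polyC_natr !polyC_eq0 ((pcharf0P F).1 HF) lt0n. Qed.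

Lemma half_cF : 2%:R * cF 2^-1 = 1 :> Kp F.
Proof.
have two0 : 2%:R != 0 :> F by rewrite ((pcharf0P F).1 HF).
by rewrite /cF -!polyC_natr -!polyCM mulfV.
Qed.

Lemma is_deriv_Dx : is_deriv (@Dx F).
Proof. exact: (is_deriv_ext _ (is_deriv_deriv (Kp F))). Qed.

Lemma Dx_polyC (g : Pp F) : Dx g%:P = g^`()%:P * 'X.
Proof. exact: (ext_der_polyC _ (is_deriv_deriv (Kp F))). Qed.

Lemma Dx_polyX : Dx 'X = (ellwp F)%:P :> Wp F.
Proof. exact: (ext_der_polyX _ (is_deriv_deriv (Kp F))). Qed.

Lemma deriv_fwp : (fwp F)^`() = 2%:R * ellwp F.
Proof.
rewrite -[ellwp F](half_deriv_fw (g2 F) (g3 F) half_cF).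
by rewrite mulrA half_polyC ?mul1r // half_cF.
Qed.

Lemma Dx_relW : Dx (relW F) = 0.
Proof. exact: (ext_der_rel (is_deriv_deriv (Kp F)) deriv_fwp). Qed.

Lemma size_relW : size (relW F) = 3.
Proof. by rewrite /relW size_XnsubC. Qed.

Lemma relW_monic : relW F \is monic.
Proof. exact: monicXnsubC. Qed.

End Weierstrass.

(** The congruence [eqV] becomes equality in an actual ring with derivation; the final argument uses
    the quotient only through these four properties. *)
Lemma weierstrass_quotient (F : fieldType) : [pchar F] =i pred0 ->
  exists (V : comNzRingType) (pi : {rmorphism Wp F -> V}) (D : V -> V),
    [/\ is_deriv D, forall h, pi (Dx h) = D (pi h),
        forall f g, pi f = pi g <-> eqV f g
      & injective (pi \o polyC)].
Proof.
move=> HF; have size1 : (1 < size (relW F))%N by rewrite size_relW.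
exists {poly %/ relW F}, (in_qpoly (relW F)), (quot_der (@Dx F)).
split.
- exact: (is_deriv_quot (relW_monic F) size1 (is_deriv_Dx F) (Dx_relW HF)).
- exact: (proj_der (relW_monic F) size1 (is_deriv_Dx F) (Dx_relW HF)).
- exact: (proj_eqP (relW_monic F) size1).
exact: (proj_polyC_inj (relW_monic F) size1).
Qed.

Lemma rmorph_eqK (W V : comNzRingType) (phi : {rmorphism W -> V}) (dW : W -> W)
    (D : V -> V) (b : nat -> W) (k w : W) N n :
  (forall g, phi (dW g) = D (phi g)) ->
  phi (smul b (fun i => dW (dW (b i))) n
       - k * smul (fun i => dW (b i)) (fun i => dW (b i)) n
       - 2%:R * smul b b n.+1 - (2 * N)%:R * w * smul b b n)
  = eqK D (N%:R * phi w) (phi k) (phi \o b) n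
    - 2%:R * smul (phi \o b) (phi \o b) n.+1.
Proof.
move=> phiD; rewrite !rmorphB !rmorphM !rmorph_smul !rmorph_nat /eqK natrM.
rewrite [LHS]addrAC -[_ * N%:R * phi w]mulrA.
congr (_ - _ * _ - _ * _ - _); apply: eq_smul => i _ //=; by rewrite !phiD.
Qed.

Lemma rmorph_eq0 (A C : nzRingType) (phi : {rmorphism A -> C}) x :
  injective phi -> phi x = 0 -> x = 0.
Proof. by move=> phi_inj phix; apply: phi_inj; rewrite phix rmorph0. Qed.

Lemma double_sqr (R : comNzRingType) (x z : R) :
  2%:R * x = 1 -> 2%:R * (x ^+ 2 * z) = x * z.
Proof. by move=> x2; rewrite expr2 !mulrA x2 mul1r. Qed.

Lemma quadruple_sqr (R : comNzRingType) (x z : R) :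
  2%:R * x = 1 -> 4%:R * (x ^+ 2 * z) = z.
Proof.
move=> x2; transitivity ((2%:R * x) ^+ 2 * z); first by ring.
by rewrite x2 expr1n mul1r.
Qed.

(** * Proof of the claims in the quotient ring *)

Section Assembly.
Variables (F : fieldType) (V : comNzRingType) (pi : {rmorphism Wp F -> V}).
Variables (D : V -> V) (p : nat) (b : nat -> Wp F).
Hypothesis HF : [pchar F] =i pred0.
Hypothesis derD : is_deriv D.
Hypothesis piD : forall h, pi (Dx h) = D (pi h).
Hypothesis pi_eqV : forall f g, pi f = pi g <-> eqV f g.
Hypothesis pi_inj : injective (pi \o polyC).
Hypothesis hb : bseries p b.

Let iota : {rmorphism Pp F -> V} := pi \o polyC.
Let kap : {rmorphism Kp F -> V} := iota \o polyC.
Let y : V := pi 'X.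
Let B : nat -> V := pi \o b.
Let h : V := iota (cF 2^-1)%:P.

Lemma pi_kW k : pi (kW k) = kap k. Proof. by []. Qed.

Lemma pi_wpW : pi (wpW F) = iota 'X. Proof. by []. Qed.

Lemma D_iotaE g : D (iota g) = iota g^`() * y.
Proof. by rewrite -piD Dx_polyC rmorphM. Qed.

Lemma yyE : y * y =
  iota (4%:R * 'X ^+ 3 - (g2 F)%:P * 'X - (g3 F)%:P).
Proof.
rewrite -rmorphM; apply/pi_eqV; exists 1.
by rewrite mul1r -expr2.
Qed.

Lemma DyE : D y = iota (6%:R * 'X ^+ 2 - (cF 2^-1 * g2 F)%:P).
Proof. by rewrite -piD Dx_polyX. Qed.

Lemma B0E : B 0%N = 1.
Proof. by case: hb => /pi_eqV; rewrite rmorph1. Qed.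

Lemma solBE : solves D ((p * p.+1)%:R * iota 'X) h (fun n => (n == 0)%N%:R) B.
Proof.
have [_ [_ eqb]] := hb; split=> [|n]; first by rewrite smul0 B0E mulr1.
rewrite mulr0.
have := rmorph_eqK b (kW (cF 2^-1)) (wpW F) (p * p.+1) n piD.
rewrite pi_kW pi_wpW => eqK_b; apply: etrans (esym eqK_b) _.
apply: etrans _ (rmorph0 pi); exact: (pi_eqV _ _).2 (eqb n).
Qed.


Lemma pi_rb r n : pi (rb r b n) = smul (kap \o r) B n.
Proof. exact: rmorph_smul. Qed.

Let hf2 : 2%:R * cF 2^-1 = 1 := half_cF HF.

Lemma polynomial_part (S : {poly Kp F}) (r : nat -> Kp F) :
  is_spectral p S -> sqrt_ser (2 * p + 1) S 1 r ->
  exists c : nat -> Pp F,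
    [/\ c 0%N = 1, forall n, (p < n)%N -> c n = 0,
        forall n, eqV (rb r b n) (c n)%:P,
        forall n, (size (c n) <= p.+1)%N
      & exists n, size (c n) = p.+1].
Proof.
move=> specS [r0 sqS].
have [beta [beta0 sbeta Bbeta rec]] :=
  polynomial_solution pi_inj derD hf2 D_iotaE yyE DyE B0E solBE.
have h2 : 2%:R * h = 1 by exact: iota_half.
have [f [sf fp eqf]] :=
  spectral_solution derD h2 piD (fun f g => (pi_eqV f g).2) specS.
have cE := normalised_solution derD hf2 D_iotaE B0E solBE r0 sf fp eqf.
(* [c] lifts the rescaled series to polynomials in wp; its image equals [revc p f], which makes it a
   polynomial in lambda. *)
pose c := smul (polyC \o r) beta.
have iota_c n : iota (c n) = smul (kap \o r) B n.
  by rewrite rmorph_smul; apply: eq_smul => i _ //=; rewrite -Bbeta.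
have cf n : iota (c n) = revc p f n.
  rewrite iota_c cE // => i.
  rewrite -[smul r r i]mul1r -[X in X * _](expr1n _ 2) sqS.
  exact: rmorph_revc.
have c_big n : (p < n)%N -> c n = 0.
  move=> lt_pn; apply: (rmorph_eq0 (phi := iota) pi_inj).
  by rewrite cf /revc leqNgt lt_pn.
have sz_term n (i : 'I_n.+1) :
    (size ((r i)%:P * beta (n - i)%N)%R <= (n - i).+1)%N.
  rewrite mul_polyC; apply: leq_trans (size_scale_leq _ _) (sbeta _).
have sc n : (size (c n) <= p.+1)%N.
  have [le_np|/c_big ->] := leqP n p; last by rewrite size_poly0.
  apply: leq_trans (size_sum _ _ _) _; apply/bigmax_leqP => i _.
  by apply: leq_trans (sz_term n i) _; lia.
exists c; split=> //.
- by rewrite /c smul0 /= r0 beta0 mulr1.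
- by move=> n; apply/pi_eqV; rewrite pi_rb -iota_c.
(* In [c p] the power wp^p comes from the term [i = 0] alone, since the other [beta (p - i)] have
   lower degree. Its coefficient is that of [beta p], nonzero by [lead_neq0]. *)
exists p; apply/eqP; rewrite eqn_leq sc ltnNge.
apply/negP => /leq_sizeP/(_ p (leqnn p)).
rewrite /c /smul coef_sum big_ord_recl big1 ?addr0 => [|i _]; last first.
  rewrite nth_default //; apply: leq_trans (sz_term p (lift ord0 i)) _.
  by rewrite /= /bump /=; have := ltn_ord i; lia.
rewrite /= r0 mul1r subn0; apply/eqP.
apply: (lead_neq0 (natK_neq0 HF) (al := fun n => (beta n)`_n)) rec _ _ => //.
by rewrite beta0 coef1.
Qed.

Lemma explicit_part1 r : p = 1%N -> sqrt_ser 3 (D1 F) 2%:R r ->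
  forall n, eqV (2%:R * rb r b n) (2%:R * (revc 1 (N1 F) n)%:P).
Proof.
move=> p1 [r0 sqr] n; apply/pi_eqV; rewrite !rmorphM pi_rb.
congr (_ * _).
exact: (explicit1 derD hf2 D_iotaE yyE DyE B0E solBE r0 p1 sqr n).
Qed.

Lemma explicit_part2 r : p = 2%N -> sqrt_ser 5 (D2 F) 2%:R r ->
  forall n, eqV (2%:R * rb r b n) (kW (cF 2^-1) * (revc 2 (N2 F) n)%:P).
Proof.
move=> p2 [r0 sqr] n; apply/pi_eqV.
rewrite (rmorphM pi) (rmorphM pi (kW _)) pi_rb pi_kW (rmorph_nat pi).
have eqRB := explicit2 derD hf2 D_iotaE yyE DyE B0E solBE r0 p2 sqr n.
apply: etrans (congr1 _ eqRB) _.
exact: (@double_sqr V h (iota (revc 2 (N2 F) n)) (half_unit iota hf2)).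
Qed.

Lemma explicit_part3 r : p = 3%N -> sqrt_ser 6 (D3 F) 4%:R r ->
  forall n, eqV (4%:R * rb r b n) (revc 3 (N3 F) n)%:P.
Proof.
move=> p3 [r0 sqr] n; apply/pi_eqV.
rewrite (rmorphM pi) pi_rb (rmorph_nat pi).
have eqRB := explicit3 derD hf2 D_iotaE yyE DyE B0E solBE r0 p3 sqr n.
apply: etrans (congr1 _ eqRB) _.
exact: (@quadruple_sqr V h (iota (revc 3 (N3 F) n)) (half_unit iota hf2)).
Qed.

End Assembly.

Theorem theorem1p13 (F : fieldType) (HF : [pchar F] =i pred0) (p : nat)
  (b : nat -> Wp F) :
  bseries p b ->
  (forall (S : {poly Kp F}) (r : nat -> Kp F),
     is_spectral p S -> sqrt_ser (2 * p + 1) S 1 r ->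
     exists c : nat -> Pp F,
       [/\ c 0%N = 1, forall n, (p < n)%N -> c n = 0,
           forall n, eqV (rb r b n) (c n)%:P,
           forall n, (size (c n) <= p.+1)%N
         & exists n, size (c n) = p.+1]) /\
  (p = 1%N -> forall r, sqrt_ser 3 (D1 F) 2%:R r ->
     forall n, eqV (2%:R * rb r b n) (2%:R * (revc 1 (N1 F) n)%:P)) /\
  (p = 2%N -> forall r, sqrt_ser 5 (D2 F) 2%:R r ->
     forall n, eqV (2%:R * rb r b n) (kW (cF 2^-1) * (revc 2 (N2 F) n)%:P)) /\
  (p = 3%N -> forall r, sqrt_ser 6 (D3 F) 4%:R r ->
     forall n, eqV (4%:R * rb r b n) ((revc 3 (N3 F) n)%:P)).
Proof.
move=> hb; have [V [pi [D [derD piD pi_eqV pi_inj]]]] := weierstrass_quotient HF.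
split; first by move=> S r; apply: (polynomial_part HF derD piD pi_eqV pi_inj hb).
split; first by move=> p1 r; apply: (explicit_part1 HF derD piD pi_eqV hb p1).
split=> [p2 r|p3 r].
  exact: (explicit_part2 HF derD piD pi_eqV hb p2).
exact: (explicit_part3 HF derD piD pi_eqV hb p3).
Qed.
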